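(* Let $\xi:\mathbb{N}\to\mathbb{N}$ be the function computed in the limit by the procedure described in the context. Then $\xi$ is limit-computable (the procedure on input $n$ first outputs $0$, and its final output, if any, is $\xi(n)$), and $\xi$ cannot be bounded by any computable function: for every computable function $\Gamma:\mathbb{N}\to\mathbb{N}$ there exists $n\in\mathbb{N}$ with $\xi(n)>\Gamma(n)$.
   Context: $\mathbb{N}$ denotes the set of non-negative integers. The procedure, on input $n\in\mathbb{N}$, first outputs $0$. It then writes $210\cdot(n+1)=p_1^{t(1)}\cdots p_s^{t(s)}$ with primes $p_1<\cdots<p_s$ and positive integers $t(1),\ldots,t(s)$ (so $p_1=2,p_2=3,p_3=5,p_4=7$), and forms a system $S$ of equations: for each positive integer $i$ with $4i\leq s$, if $t(4i)=1$ it includes $x_{t(4i-3)}=1$; if $t(4i)=2$ it includes $x_{t(4i-3)}+x_{t(4i-2)}=x_{t(4i-1)}$; if $t(4i)>2$ it includes $x_{t(4i-3)}\cdot x_{t(4i-2)}=x_{t(4i-1)}$. Then for $m=2,3,4,\ldots$ in turn, it writes $m=q_1^{e_1}\cdots q_k^{e_k}$ with primes $q_1<\cdots<q_k$ and $e_i\geq 1$, sets $w=(w_1,\ldots,w_k)=(e_1-1,\ldots,e_k-1)$, and stops at the first $m$ such that every equation of $S$ has all its variable indices in $\{1,\ldots,k\}$ and holds when each $x_i$ is replaced by $w_i$. If it stops, it outputs $\max(w_1,\ldots,w_k)$ and this is $\xi(n)$; if it never stops, $\xi(n)=0$ (the last output). A function $\xi:\mathbb{N}\to\mathbb{N}$ is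 limit-computable if there is a computable $\varphi:\mathbb{N}\times\mathbb{N}\to\mathbb{N}$ with $\xi(n)=\lim_{l\to\infty}\varphi(n,l)$ for all $n$. *)

(* Defs.v *)
From mathcomp Require Import all_boot.
From mathcomp Require Import boolp.

Set Implicit Arguments.
Unset Strict Implicit.
Unset Printing Implicit Defensive.

(** * Partial recursive functions *)

Inductive recfun : nat -> Type :=
| RZero n : recfun n
| RSucc : recfun 1
| RProj n (i : 'I_n) : recfun n
| RComp k n (f : recfun k) (g : 'I_k -> recfun n) : recfun n
| RPrim n (f : recfun n) (g : recfun n.+2) : recfun n.+1
| RMin n (f : recfun n.+1) : recfun n.

(** [rgraph e v y]: the partial function denoted by [e] is defined at [v],
    with value [y].  The recursion variable of [RPrim] and the search variable
    of [RMin] come first; in [RPrim] the sequence [s] lists the successive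
    values of the recursion.  [RMin] requires [f] to be defined at every
    argument smaller than the least zero. *)
Fixpoint rgraph n (e : recfun n) : n.-tuple nat -> nat -> Prop :=
  match e in recfun n return n.-tuple nat -> nat -> Prop with
  | RZero _ => fun _ y => y = 0
  | RSucc => fun v y => y = (thead v).+1
  | RProj _ i => fun v y => y = tnth v i
  | RComp k _ f g => fun v y =>
      exists2 w : k.-tuple nat,
        forall i, rgraph (g i) v (tnth w i) & rgraph f w y
  | RPrim n f g => fun v y =>
      exists s : nat -> nat,
        [/\ rgraph f [tuple of behead v] (s 0),
            forall i, i < thead v ->
              rgraph g [tuple of i :: s i :: behead v] (s i.+1)
          & y = s (thead v)]
  | RMin n f => fun v y =>
      rgraph f [tuple of y :: v] 0 /\
      forall i, i < y -> exists z, rgraph f [tuple of i :: v] z.+1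
  end.

Definition computable (f : nat -> nat) : Prop :=
  exists e : recfun 1, forall x, rgraph e [tuple x] (f x).

Definition computable2 (f : nat -> nat -> nat) : Prop :=
  exists e : recfun 2, forall x y, rgraph e [tuple x; y] (f x y).

Definition has_limit (u : nat -> nat) (a : nat) : Prop :=
  exists L, forall l, L <= l -> u l = a.

Definition limit_computable (f : nat -> nat) : Prop :=
  exists2 phi : nat -> nat -> nat,
    computable2 phi & forall n, has_limit (phi n) (f n).

(** * The procedure *)

(** Variables are numbered from 1. *)
Inductive equation :=
| EqOne of nat                (* [EqOne a]     : x_a = 1         *)
| EqAdd of nat & nat & nat    (* [EqAdd a b c] : x_a + x_b = x_c *)
| EqMul of nat & nat & nat.   (* [EqMul a b c] : x_a * x_b = x_c *)

(** The exponents in the factorization of [m] into primes listed in increasing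
    order; they are all positive. *)
Definition exponents (m : nat) : seq nat := [seq f.2 | f <- prime_decomp m].

(** [t j] is the [j]-th exponent, numbered from 1.  Exponents being positive,
    the last branch of [eqn] is the case [2 < t (4 * i)]. *)
Definition system (n : nat) : seq equation :=
  let ts := exponents (210 * n.+1) in
  let t j := nth 0 ts j.-1 in
  let eqn i :=
    if t (4 * i) == 1 then EqOne (t (4 * i - 3))
    else if t (4 * i) == 2
         then EqAdd (t (4 * i - 3)) (t (4 * i - 2)) (t (4 * i - 1))
         else EqMul (t (4 * i - 3)) (t (4 * i - 2)) (t (4 * i - 1)) in
  [seq eqn i | i <- iota 1 (size ts %/ 4)].

Definition witness (m : nat) : seq nat := [seq e.-1 | e <- exponents m].

Definition satisfies (w : seq nat) (E : equation) : bool :=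
  let ok a := 0 < a <= size w in
  let x a := nth 0 w a.-1 in
  match E with
  | EqOne a => ok a && (x a == 1)
  | EqAdd a b c => [&& ok a, ok b, ok c & x a + x b == x c]
  | EqMul a b c => [&& ok a, ok b, ok c & x a * x b == x c]
  end.

Definition accepts (n m : nat) : bool :=
  (1 < m) && all (satisfies (witness m)) (system n).

Definition answer (m : nat) : nat := \max_(x <- witness m) x.

(** The outputs written on input [n] by the time the candidates
    [m = 2, ..., l + 1] have been tested, or the procedure has stopped. *)
Definition outputs (n l : nat) : seq nat :=
  0 :: [seq answer m | m <- take 1 [seq m <- iota 2 l | accepts n m]].

Definition last_output (n l : nat) : nat := last 0 (outputs n l).

Definition xi (n : nat) : nat :=
  match pselect (exists m, accepts n m) with
  | left stops => answer (ex_minn stops)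
  | right _ => 0
  end.

(* Main.v *)
(** Matiyasevich's theorem enters through one bounded statement about a
    computable [Gamma]: the relation "[Gamma i < y] for all [i < 2 ^ V]" between
    [V] and [y] is Diophantine, hence expressed by a fixed finite system in the
    unknowns [V], [y] and auxiliary ones.  Adding the chain [x_1 = 1],
    [x_2 = x_1 + x_1], [x_(j+1) = x_j * x_j] forces [V = 2 ^ 2 ^ a] at the cost
    of only [a.+2] equations, so the code [n] of the whole system is
    [2 ^ 2 ^ O(a)], which is below [2 ^ V = 2 ^ 2 ^ 2 ^ a] for large [a].
    Every solution then has [y > Gamma n], whence [xi n > Gamma n].

    That graphs of recursive functions are Diophantine is proved through the
    Lucas sequences [a_(n+2) = b a_(n+1) - a_n], which give exponentiation, then
    binomial coefficients and factorials as digits; bounded quantifiers and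
    primitive recursion are eliminated by the Chinese remainder theorem with the
    moduli [1 + z!^2 / (k+1)], whose product over [k < y] is the binomial
    coefficient ['C(z!^2 + y, y)]. *)
Require Import Defs.
From mathcomp Require Import all_boot all_order all_algebra.
From mathcomp Require Import boolp.
From mathcomp Require Import zify ring.

Set Implicit Arguments.
Unset Strict Implicit.
Unset Printing Implicit Defensive.

(** * Lucas sequences *)

Section Lucas.

Import Order.TTheory GRing.Theory Num.Theory.
Local Open Scope ring_scope.

(** The obstacle is self-reference: a system cannot mention its own code [n], which depends on the
    whole system. Hence it asks for a [y] above [Gamma i] for every [i] of an initial segment, and
    all that matters is that this segment contain [n]. Each equation uses four primes, and the bound
    used for the product of [s] primes is [2 ^ 2 ^ s], so codes are bounded by a double exponential
    in the number of equations. The squaring chain alone reaches only a double exponential with a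
    smaller constant; the further power in [i < 2 ^ V] lets the segment outgrow the code. As [Gamma]
    is total, a suitable [y] exists for every [V], so the search stops; as every solution works, it
    is irrelevant which one is met first. In the Diophantine part, unknowns are indexed by arbitrary
    types while systems are finite lists. Eliminating a bounded quantifier can then replace each
    unknown by a fused one with the same index, and variables are numbered only once, at the end. *)

Fixpoint lucas_pair (b : int) (n : nat) : int * int :=
  if n is n'.+1 then let: (x, y) := lucas_pair b n' in (y, b * y - x) else (0, 1).

Definition lucas (b : int) (n : nat) : int := (lucas_pair b n).1.

Lemma lucas0 b : lucas b 0 = 0. Proof. by []. Qed.
Lemma lucas1 b : lucas b 1 = 1. Proof. by []. Qed.
Lemma lucasSS b n : lucas b n.+2 = b * lucas b n.+1 - lucas b n.
Proof. by rewrite /lucas /=; case: (lucas_pair b n). Qed.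

Lemma nat_ind2 (P : nat -> Prop) :
  P 0%N -> P 1%N -> (forall n, P n -> P n.+1 -> P n.+2) -> forall n, P n.
Proof.
move=> P0 P1 PS n; suff [] : P n /\ P n.+1 by [].
by elim: n => [//|n [Pn Pn1]]; split=> //; apply: PS.
Qed.

(** The form [x^2 - b x y + y^2] is invariant under [(x, y) -> (b x - y, x)], the step of the
    recurrence. *)
Lemma lucas_pell b n :
  lucas b n.+1 * lucas b n.+1 - b * lucas b n.+1 * lucas b n
    + lucas b n * lucas b n = 1.
Proof.
elim: n => [|n IHn]; first by rewrite lucas0 lucas1; ring.
by rewrite lucasSS -IHn; ring.
Qed.

(** An entry of the product of two powers of the companion matrix. *)
Lemma lucas_add b m n :
  lucas b (m + n).+1 = lucas b m.+1 * lucas b n.+1 - lucas b m * lucas b n.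
Proof.
elim/nat_ind2: m => [||m IH1 IH2].
- by rewrite add0n lucas0 lucas1; ring.
- by rewrite add1n !lucasSS lucas0 lucas1; ring.
- by rewrite !addSn (lucasSS b (m + n).+1) -addSn IH2 addSn IH1 !lucasSS; ring.
Qed.

Lemma lucas_add_sym b m n :
  lucas b (m + n) = lucas b m.+1 * lucas b n + lucas b m * lucas b n.+1
                    - b * lucas b m * lucas b n.
Proof.
case: n => [|n]; first by rewrite addn0 lucas0 lucas1; ring.
by rewrite addnS lucas_add lucasSS; ring.
Qed.

Lemma lucas_mono b n : 2 <= b -> 0 <= lucas b n < lucas b n.+1.
Proof.
move=> b2; elim: n => [|n IH]; first by rewrite lucas0 lucas1.
rewrite lucasSS; nia.
Qed.

Lemma lucas_ge0 b n : 2 <= b -> 0 <= lucas b n.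
Proof. by move=> /(lucas_mono n)/andP[]. Qed.

Lemma lucas_leq b m n : 2 <= b -> (m <= n)%N -> lucas b m <= lucas b n.
Proof.
move=> b2; elim: n => [|n IH]; first by rewrite leqn0 => /eqP->.
rewrite leq_eqVlt => /orP[/eqP->//|]; rewrite ltnS => /IH.
by have := lucas_mono n b2; lia.
Qed.

Lemma lucas_ltn b m n : 2 <= b -> (m < n)%N -> lucas b m < lucas b n.
Proof. by move=> b2 /(lucas_leq b2); have := lucas_mono m b2; lia. Qed.

Lemma lucas_ge_id b n : 2 <= b -> n%:Z <= lucas b n.
Proof.
move=> b2; elim: n => [//|n IH]; have := lucas_mono n b2; lia.
Qed.

Lemma lucas2 n : lucas 2 n = n%:Z.
Proof. by elim/nat_ind2: n => [//|//|n H1 H2]; rewrite lucasSS H1 H2; lia. Qed.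

(** Each term is a polynomial in [b] with integer coefficients. *)
Lemma dvdz_lucas_sub b w n : (w - b %| lucas w n - lucas b n)%Z.
Proof.
elim/nat_ind2: n => [||n /dvdzP[p Hp] /dvdzP[q Hq]].
- by rewrite subrr dvdz0.
- by rewrite subrr dvdz0.
apply/dvdzP; exists (lucas w n.+1 + b * q - p); rewrite !lucasSS.
have -> : lucas w n.+1 = lucas b n.+1 + q * (w - b) by lia.
have -> : lucas w n = lucas b n + p * (w - b) by lia.
ring.
Qed.

(** Vieta descent: for fixed [y], the second root [z = b y - x] satisfies [z x = y^2 - 1], so
    [0 <= z < y] and [(y, z)] is a smaller solution. *)
Lemma lucas_pell_inv b (x y : nat) : (y < x)%N ->
  x%:Z * x%:Z - b * x%:Z * y%:Z + y%:Z * y%:Z = 1 ->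
  exists n, x%:Z = lucas b n.+1 /\ y%:Z = lucas b n.
Proof.
elim/ltn_ind: y x => -[|y] IH x ltyx E.
  exists 0%N; rewrite lucas0 lucas1; split=> //.
  have : (x * x = 1)%N by lia.
  by move/eqP; rewrite muln_eq1 => /andP[/eqP-> _].
set Y := y.+1 in ltyx E IH *.
pose z : int := b * Y%:Z - x%:Z.
have Ez : z * x%:Z = Y%:Z * Y%:Z - 1 by rewrite /z -E; ring.
have z0 : 0 <= z by rewrite /Y in Ez ltyx *; nia.
have zy : z < Y%:Z by rewrite /Y in Ez ltyx *; nia.
have [z' Ez'] : exists z' : nat, z = z'%:Z by exists `|z|%N; lia.
have [|||n [E1 E2]] := IH z' _ Y.
- by lia.
- by lia.
- by rewrite -Ez' -E /z; ring.
exists n.+1; split=> //; rewrite lucasSS -E1 -E2 -Ez' /z; ring.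
Qed.

Lemma lucas_pell_inv_l b (x y : nat) : 2 < b ->
  x%:Z * x%:Z - b * x%:Z * y%:Z + y%:Z * y%:Z = 1 ->
  exists n, x%:Z = lucas b n.
Proof.
move=> b2 E; case: (ltngtP y x) => [lt|lt|eq].
- by have [n [E1 _]] := lucas_pell_inv lt E; exists n.+1.
- have [|n [_ E1]] := @lucas_pell_inv b y x lt; last by exists n.
  by rewrite -E; ring.
- by rewrite eq in E; nia.
Qed.

Lemma lucas_mul_succ b l q :
  exists z, lucas b (l * q).+1 = lucas b l.+1 ^+ q + lucas b l * z.
Proof.
elim: q => [|q [z IH]].
  by exists 0; rewrite muln0 lucas1; ring.
rewrite mulnS lucas_add IH.
exists (lucas b l.+1 * z - lucas b (l * q)); rewrite exprS; ring.
Qed.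

(** Modulo [lucas b l], the [l]-th power of the companion matrix is the scalar [lucas b l.+1]; this
    is the expansion of its [q]-th power to second order. At [q = 0] the value of [q.-1] is
    harmless, its coefficient being 0. *)
Lemma lucas_mul b l q :
  exists z, lucas b (l * q) =
    lucas b l * (q%:Z * lucas b l.+1 ^+ q.-1 + lucas b l * z).
Proof.
elim: q => [|q [z IH]].
  by exists 0; rewrite muln0 lucas0; ring.
have [z' E] := lucas_mul_succ b l q.
exists (lucas b l.+1 * z + z'
  - b * (q%:Z * lucas b l.+1 ^+ q.-1 + lucas b l * z)).
rewrite mulnS lucas_add_sym E IH /=.
have -> : q.+1%:Z = q%:Z + 1 by lia.
case: q {IH E} => [|q]; first by rewrite /=; ring.
by rewrite /= exprS; ring.
Qed.

Lemma coprimez_lucasS b n : coprimez (lucas b n) (lucas b n.+1).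
Proof.
apply/coprimezP; exists (lucas b n - b * lucas b n.+1, lucas b n.+1) => /=.
by rewrite -(lucas_pell b n); ring.
Qed.

Lemma dvdz_small (v x : int) : (v %| x)%Z -> - v < x < v -> x = 0.
Proof.
move=> /dvdzP[d ->] /andP[lt1 lt2].
have [d0|[->|d0]] : d <= -1 \/ d = 0 \/ 1 <= d by lia.
- have v0 : 0 < v by lia.
  suff : d * v <= - v by lia.
  nia.
- by rewrite mul0r.
- have v0 : 0 < v by lia.
  suff : v <= d * v by lia.
  nia.
Qed.

(** With [k = l q + r], the term at [k] is, modulo [lucas b l], the term at [r] times a unit. As
    [r < l], divisibility forces that term, hence [r], to be 0. *)
Lemma dvdn_lucas b l k : 2 <= b -> (0 < l)%N ->
  (lucas b l %| lucas b k)%Z -> (l %| k)%N.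
Proof.
move=> b2 l0.
rewrite {1}(divn_eq k l) mulnC lucas_add_sym.
have [z E] := lucas_mul b l (k %/ l).
have [z' E'] := lucas_mul_succ b l (k %/ l).
set r := (k %% l)%N; set q := (k %/ l)%N.
have rl : (r < l)%N by rewrite ltn_mod.
have cop : coprimez (lucas b l) (lucas b (l * q).+1).
  have := coprimezXr q (coprimez_lucasS b l).
  move=> /coprimezP[[f g] /= H]; apply/coprimezP; exists (f - g * z', g) => /=.
  by rewrite E' -H; ring.
set c := lucas b (l * q).+1 in cop *.
have -> : c * lucas b r + lucas b (l * q) * lucas b r.+1
            - b * lucas b (l * q) * lucas b r
  = c * lucas b r + lucas b l * ((q%:Z * lucas b l.+1 ^+ q.-1 + lucas b l * z)
                    * (lucas b r.+1 - b * lucas b r)) by rewrite E; ring.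
move=> /dvdzP[d Hd].
have : (lucas b l %| c * lucas b r)%Z.
  apply/dvdzP; exists (d - (q%:Z * lucas b l.+1 ^+ q.-1 + lucas b l * z)
                    * (lucas b r.+1 - b * lucas b r)).
  by rewrite mulrBl -Hd; ring.
rewrite Gauss_dvdzr // => H.
have r0 : lucas b r = 0.
  apply: (dvdz_small H).
  have := lucas_ltn b2 rl; have := lucas_ge0 r b2; lia.
have := lucas_ge_id r b2; rewrite r0 lez_nat leqn0 => r00.
exact: r00.
Qed.

(** The bridge from values to indices: by the second-order expansion, the square divides the term at
    [l q] only if [lucas b l] divides [q]. Divisibility of terms thus controls an index without
    mentioning it. *)
Lemma dvdn_lucas_sq b l k : 2 <= b -> (0 < l)%N ->
  (lucas b l * lucas b l %| lucas b k)%Z -> (lucas b l %| k%:Z)%Z.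
Proof.
move=> b2 l0 H.
have lk : (l %| k)%N.
  by apply: dvdn_lucas b2 l0 _; apply: dvdz_trans H; apply: dvdz_mulr.
have /dvdnP[q Eq] := lk; rewrite mulnC in Eq.
have pos : 0 < lucas b l by have := lucas_ge_id l b2; lia.
have [z E] := lucas_mul b l q.
move: H; rewrite Eq E dvdz_mul2l ?gt_eqF // => /dvdzP[d Hd].
have H : (lucas b l %| q%:Z * lucas b l.+1 ^+ q.-1)%Z.
  by apply/dvdzP; exists (d - z); rewrite mulrBl -Hd; ring.
rewrite Gauss_dvdzl ?coprimezXr ?coprimez_lucasS // in H.
by rewrite PoszM; apply: dvdz_mull.
Qed.

Lemma lucas_sq_dvd b l :
  (lucas b l * lucas b l %| lucas b (l * `|lucas b l|))%Z.
Proof.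
have [z ->] := lucas_mul b l `|lucas b l|.
apply: dvdz_mul => //; apply: rpredD; last exact: dvdz_mulr.
by apply: dvdz_mulr; rewrite dvdzE /=.
Qed.

(* [lucas b k.+2 - lucas b k] is the trace of the [k.+1]-st power of the
   companion matrix, whose determinant is 1. *)
Lemma lucas_add_double b k n :
  lucas b (k.+1.*2 + n) + lucas b n
    = (lucas b k.+2 - lucas b k) * lucas b (k.+1 + n).
Proof.
elim/nat_ind2: n => [||n IH1 IH2].
- rewrite !addn0 lucas0 -addnn addSn lucas_add lucasSS; ring.
- rewrite !addn1 lucas1 -addnn lucas_add -[1](lucas_pell b k.+1) lucasSS; ring.
- move: (lucas b k.+2 - lucas b k) IH1 IH2 => v IH1 IH2.
  have aS m : lucas b (m + n.+2) = b * lucas b (m + n.+1) - lucas b (m + n).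
    by rewrite !addnS lucasSS.
  rewrite !aS (lucasSS b n).
  transitivity (b * (lucas b (k.+1.*2 + n.+1) + lucas b n.+1)
                - (lucas b (k.+1.*2 + n) + lucas b n)); first ring.
  by rewrite IH1 IH2; ring.
Qed.

(** This is [lucas_add_double] at the negative index [i - (k+1)], terms at opposite indices being
    opposite. *)
Lemma lucas_add_reflect b k i : (i <= k.+1)%N ->
  lucas b (k.+1 + i) - lucas b (k.+1 - i)
    = (lucas b k.+2 - lucas b k) * lucas b i.
Proof.
elim/nat_ind2: i => [||i IH1 IH2] le.
- by rewrite subn0 addn0 lucas0; ring.
- by rewrite addn1 subn1 lucas1 /=; ring.
have := IH1 (ltnW (ltnW le)); have := IH2 (ltnW le).
have -> : (k.+1 - i = (k.+1 - i.+2).+2)%N by lia.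
have -> : (k.+1 - i.+1 = (k.+1 - i.+2).+1)%N by lia.
have aS m : lucas b (m + i.+2) = b * lucas b (m + i.+1) - lucas b (m + i).
  by rewrite !addnS lucasSS.
move: (lucas b k.+2 - lucas b k) (k.+1 - i.+2)%N => v m.
rewrite aS (lucasSS b i) (lucasSS b m) => H2 H1.
transitivity (b * (lucas b (k.+1 + i.+1) - lucas b m.+1)
  - (lucas b (k.+1 + i) - (b * lucas b m.+1 - lucas b m))); first ring.
by rewrite H1 H2; ring.
Qed.

(** Modulo the trace, the sequence changes sign under a shift by [2(k+1)] and is symmetric about
    [k+1]. Any index therefore folds into [[0, k+1]], with a sign [e] on the value and a sign [e']
    on the index. *)
Lemma lucas_fold b k n : exists j : nat, (j <= k.+1)%N /\
  exists e e' : int, [/\ e = 1 \/ e = -1, e' = 1 \/ e' = -1,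
   (lucas b k.+2 - lucas b k %| lucas b n - e * lucas b j)%Z
   & (2 * k.+1%:Z %| n%:Z - e' * j%:Z)%Z].
Proof.
elim/ltn_ind: n => n IH.
case: (leqP n k.+1) => [le|lt].
  exists n; split=> //; exists 1, 1; rewrite !mul1r !subrr !dvdz0.
  by split=> //; left.
case: (leqP n (k.+1.*2)) => [le|lt2].
  exists (k.+1.*2 - n)%N; split; first by lia.
  exists 1, (-1); split; [by left|by right| |].
  - have := @lucas_add_reflect b k (n - k.+1).
    have -> : (k.+1 + (n - k.+1) = n)%N by lia.
    have -> : (k.+1 - (n - k.+1) = k.+1.*2 - n)%N by lia.
    move=> H; rewrite mul1r H; last by lia.
    exact: dvdz_mulr.
  - apply/dvdzP; exists 1; lia.
have [|j [jk [e [e' [He He' D1 D2]]]]] := IH (n - k.+1.*2)%N; first by lia.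
exists j; split=> //; exists (- e), e'; split=> //.
- by case: He => ->; [right|left]; lia.
- have := lucas_add_double b k (n - k.+1.*2).
  have -> : (k.+1.*2 + (n - k.+1.*2) = n)%N by lia.
  move=> H; have -> : lucas b n - - e * lucas b j =
   (lucas b k.+2 - lucas b k) * lucas b (k.+1 + (n - k.+1.*2))
   - (lucas b (n - k.+1.*2) - e * lucas b j) by rewrite -H; ring.
  by apply: rpredB => //; apply: dvdz_mulr.
- have -> : n%:Z - e' * j%:Z = ((n - k.+1.*2)%N%:Z - e' * j%:Z) + 2 * k.+1%:Z
    by lia.
  exact: rpredD.
Qed.

Lemma eq_of_dvdz_pm (v a a' : nat) (e : int) : e = 1 \/ e = -1 ->
  (2 * a < v)%N -> (2 * a' < v)%N -> (v%:Z %| a%:Z - e * a'%:Z)%Z -> a = a'.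
Proof.
move=> He va va' /dvdz_small E.
by case: He E => -> E; have := E; lia.
Qed.

Lemma odd_abszB (x y : int) : odd `|x - y| = odd `|x| (+) odd `|y|.
Proof. by lia. Qed.

(** Parity has period 2 for even [b] and 3 for odd [b], so 6 serves both cases. *)
Lemma odd_lucas (b : int) m : odd `|lucas b (6 * m).+1|.
Proof.
pose p n := odd `|lucas b n|.
have pSS n : p n.+2 = odd `|b| && p n.+1 (+) p n.
  by rewrite /p lucasSS odd_abszB abszM oddM.
suff [] : p (6 * m).+1 /\ ~~ p (6 * m)%N by [].
elim: m => [//|m [H1 H0]].
rewrite mulnS !addSn add0n !pSS (negbTE H0) H1.
by case: (odd _).
Qed.

End Lucas.

(** * Diophantine definition of the Lucas sequences *)

Section LucasDefinition.

Import Order.TTheory GRing.Theory Num.Theory.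
(* [ring_scope] is opened only for the notation [%:Z]. *)
Local Open Scope ring_scope.
Local Open Scope nat_scope.

Definition lucasn (b n : nat) : nat := `|lucas b n|%N.

Lemma lucasnE b n : 2 <= b -> (lucasn b n)%:Z = lucas b n.
Proof. by move=> b2; rewrite /lucasn gez0_abs // lucas_ge0. Qed.

Lemma dvdz_subE (d m n : nat) : (d%:Z %| (m%:Z - n%:Z)%R)%Z = (m == n %[mod d]).
Proof. by rewrite -eqz_mod_dvd !modz_nat eqz_nat. Qed.

(** Here [u] and [s] are terms for the base [b], [x] is a term for the base [w], and [v] is the
    trace attached to the index of [s]. Since [w] is [b] modulo [v] and 2 modulo [u], and the
    sequence for 2 is the identity, [x] shows its value for [b] modulo [v] and its index modulo [u].
    The condition [u * u %| s] makes folding modulo [v] compatible with reading the index modulo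
    [u]. *)
Definition lucas_system (b c a u t s r v w x y : nat) : Prop :=
  [/\ [/\ u * u + t * t = b * u * t + 1,
      s * s + r * r = b * s * r + 1,
      x * x + y * y = w * x * y + 1 & b <= w],
      [/\ r < s, u * u %| s, v + 2 * r = b * s,
      w = b %[mod v] & w = 2 %[mod u]],
      [/\ 2 * a < u, 2 * a < v & x = a %[mod v]]
    & 2 * c < u /\ x = c %[mod u]].

Lemma pell_int (b u t : nat) : u * u + t * t = b * u * t + 1 ->
  (u%:Z * u%:Z - b%:Z * u%:Z * t%:Z + t%:Z * t%:Z = 1)%R.
Proof. lia. Qed.

(** Let [x] have index [n], folded to [j]. Modulo [v], [x] is plus or minus the term at [j]; modulo
    [u], which divides [k+1], it is plus or minus [j]. The size conditions turn these into
    [a = lucasn b j] and [c = j]. *)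
Lemma lucas_system_sound b c a u t s r v w x y : 4 <= b ->
  lucas_system b c a u t s r v w x y -> a = lucasn b c.
Proof.
move=> b4 [[E1 E2 E3 bw] [rs us Ev wv wu] [au av xa] [cu xc]].
have b2 : (2 <= b%:Z)%R by lia.
have [l El] : exists l, u%:Z = lucas b l.
  by apply: (lucas_pell_inv_l _ (pell_int E1)); clear - b4; lia.
have [k [Es Er]] := lucas_pell_inv rs (pell_int E2).
have [n En] : exists n, x%:Z = lucas w n.
  by apply: (lucas_pell_inv_l _ (pell_int E3)); clear - b4 bw; lia.
have [j [jk [e [e' [He He' D1 D2]]]]] := lucas_fold b k n.
have Ev' : v%:Z = (lucas b k.+2 - lucas b k)%R.
  by rewrite lucasSS -Es -Er; clear - Ev; lia.
have l0 : 0 < l by case: l El => //; rewrite lucas0; clear - au; lia.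
have uk : (u%:Z %| k.+1%:Z)%Z.
  by rewrite El; apply: dvdn_lucas_sq => //; rewrite -El -Es.
have jle : (lucas b j <= s)%R by rewrite Es; apply: lucas_leq.
have ja : a = lucasn b j.
  (* The term at [j] is at most [s], and [r < s] with [4 <= b] gives [v = b s - 2 r > 2 s]. *)
  apply: (eq_of_dvdz_pm He av).
    have : 2 * lucasn b j <= 2 * s by rewrite leq_mul2l -lez_nat lucasnE.
    by clear - Ev rs b4; nia.
  rewrite lucasnE //; have -> : (a%:Z - e * lucas b j =
     (lucas b n - e * lucas b j) + (lucas w n - lucas b n) - (x%:Z - a%:Z))%R.
    by rewrite En; ring.
  apply: rpredB; last by rewrite dvdz_subE; apply/eqP.
  apply: rpredD; first by rewrite Ev'.
  apply: dvdz_trans (dvdz_lucas_sub b w n).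
  by rewrite dvdz_subE; apply/eqP.
suff -> : c = j by [].
(* The index satisfies [j <= lucasn b j = a], and [a] is below half of [u]. *)
apply: (eq_of_dvdz_pm He' cu).
  have := lucas_ge_id j b2; have := lucasnE j b2; rewrite -ja; clear - au; lia.
have -> : (c%:Z - e' * j%:Z =
   (n%:Z - e' * j%:Z) + (lucas w n - lucas 2 n) - (x%:Z - c%:Z))%R.
  by rewrite En lucas2; ring.
apply: rpredB; last by rewrite dvdz_subE; apply/eqP.
apply: rpredD; first by apply: dvdz_trans D2; apply: dvdz_mull.
apply: dvdz_trans (dvdz_lucas_sub 2 w n).
by rewrite dvdz_subE; apply/eqP.
Qed.

Lemma lucasn_pell b m : 2 <= b ->
  lucasn b m.+1 * lucasn b m.+1 + lucasn b m * lucasn b m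
   = b * lucasn b m.+1 * lucasn b m + 1.
Proof. by move=> b2; have := lucas_pell b m; rewrite -!lucasnE //; lia. Qed.

Lemma lucasn_ge_id b n : 2 <= b -> n <= lucasn b n.
Proof. by move=> b2; rewrite -lez_nat lucasnE // lucas_ge_id. Qed.

Lemma lucasn_leq b m n : 2 <= b -> m <= n -> lucasn b m <= lucasn b n.
Proof. by move=> b2 mn; rewrite -lez_nat !lucasnE // lucas_leq. Qed.

Lemma lucasn_ltn b m n : 2 <= b -> m < n -> lucasn b m < lucasn b n.
Proof. by move=> b2 mn; rewrite -ltz_nat !lucasnE // lucas_ltn. Qed.

Lemma lucasn0 b : lucasn b 0 = 0. Proof. by []. Qed.
Lemma lucasnSS b n : 2 <= b -> lucasn b n.+2 + lucasn b n = b * lucasn b n.+1.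
Proof.
move=> b2; apply/eqP; rewrite -eqz_nat PoszD PoszM !lucasnE // lucasSS.
by rewrite subrK.
Qed.

Lemma lucasn_modn_sub d b w n : 2 <= b -> 2 <= w ->
  w = b %[mod d] -> lucasn w n = lucasn b n %[mod d].
Proof.
move=> b2 w2 /eqP wb; apply/eqP; rewrite -dvdz_subE !lucasnE //.
by apply: dvdz_trans (dvdz_lucas_sub b w n); rewrite dvdz_subE.
Qed.

Lemma lucasn_modn_id d w n : 2 <= w -> w = 2 %[mod d] -> lucasn w n = n %[mod d].
Proof.
by move=> w2 /(lucasn_modn_sub n (leqnn 2) w2) ->; rewrite /lucasn lucas2.
Qed.

Lemma lucasn_pell_ex w c : 2 <= w ->
  exists y, lucasn w c * lucasn w c + y * y = w * lucasn w c * y + 1.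
Proof.
move=> w2; case: c => [|c]; first by exists 1; rewrite lucasn0 !muln0 mul0n.
by exists (lucasn w c); apply: lucasn_pell.
Qed.

Lemma lucas_system_complete b c : 4 <= b ->
  exists u t s r v w x y, lucas_system b c (lucasn b c) u t s r v w x y.
Proof.
move=> b4; set a := lucasn b c.
have b2 : 2 <= b by apply: leq_trans b4.
(* An index that is 1 modulo 6 makes [u] odd; the factor makes [u >= l] exceed [2 a] and [2 c]. *)
pose l := (6 * (2 * a + 2 * c + 1)).+1.
pose u := lucasn b l; pose t := lucasn b l.-1.
have Pu : u * u + t * t = b * u * t + 1 by apply: lucasn_pell.
have ul : l <= u by apply: lucasn_ge_id.
have uodd : odd u by apply: odd_lucas.
have u0 : 0 < u by apply: leq_trans ul.
(* At the index [l u] the term is divisible by [u^2], by [lucas_sq_dvd]. *)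
pose K := (l * u).-1.
have EK : l * u = K.+1 by rewrite prednK // muln_gt0.
pose s := lucasn b K.+1; pose r := lucasn b K.
have Ps : s * s + r * r = b * s * r + 1 by apply: lucasn_pell.
have rs : r < s by apply: lucasn_ltn.
have us : u * u %| s.
  have := lucas_sq_dvd b l; rewrite -/(lucasn b l) -/u EK.
  by rewrite -!lucasnE.
have as_ : a <= s.
  apply: lucasn_leq => //; rewrite -EK.
  apply: (@leq_trans l); [rewrite /l; clear; lia|exact: leq_pmulr].
clearbody s r.
have [au cu] : 2 * a < u /\ 2 * c < u by move: ul; rewrite /l; clear; lia.
clearbody u t; clear EK K ul l.
have [v Ev] : exists v, v + 2 * r = b * s.
  by exists (b * s - 2 * r); rewrite subnK //; clear - rs b4; nia.
have us1 : u %| s by apply: dvdn_trans us; apply: dvdn_mulr.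
(* A common divisor divides [s] and [2 r], and is odd as [u] is; so it divides [s] and [r], and the
   Pell equation makes it 1. *)
have cop : coprime v u.
  rewrite /coprime; set g := gcdn v u.
  have gu : g %| u by apply: dvdn_gcdr.
  have gs : g %| s by apply: dvdn_trans us1.
  have g2r : g %| 2 * r.
    by rewrite -(dvdn_addr _ (dvdn_gcdl v u)) Ev dvdn_mull.
  have copg2 : coprime g 2.
    by rewrite coprimen2; apply: dvdn_odd gu uodd.
  rewrite Gauss_dvdr // in g2r.
  have : g %| b * s * r + 1.
    by rewrite -Ps dvdn_add // dvdn_mulr.
  by rewrite dvdn_addr ?dvdn1 // dvdn_mull.
have vs : 2 * s < v by clear - Ev rs b4; nia.
have v0 : 0 < v by apply: leq_ltn_trans vs.
(* The multiple of [v u] only serves to get [b <= w]. *)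
pose w := chinese v u b 2 + b * v * u.
have wv : w = b %[mod v].
  by rewrite /w mulnAC -modnDmr modnMl addn0 chinese_modl.
have wu : w = 2 %[mod u].
  by rewrite /w -modnDmr modnMl addn0 chinese_modr.
have bw : b <= w.
  rewrite /w -mulnA; apply: leq_trans (leq_addl _ _).
  by rewrite leq_pmulr // muln_gt0 v0.
clearbody w.
have w2 := leq_trans b2 bw.
have [y Py] := lucasn_pell_ex c w2.
exists u, t, s, r, v, w, (lucasn w c), y.
split; [by split | split=> // | split=> // | split=> //].
- by apply: leq_ltn_trans vs; rewrite leq_mul2l.
- exact: lucasn_modn_sub.
- exact: lucasn_modn_id.
Qed.

End LucasDefinition.

(** * Powers, binomial coefficients and factorials *)

Section LucasExp.

Import Order.TTheory GRing.Theory Num.Theory.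
Local Open Scope ring_scope.

(** Modulo [b q - q^2 - 1], [q] is a root of the characteristic polynomial [X^2 - b X + 1], so its
    powers reduce to combinations of [q] and 1 with Lucas coefficients. *)
Lemma dvdz_lucas_exp (b q : int) n :
  (b * q - q * q - 1 %| q ^+ n + b * lucas b n - (lucas b n.+1 + q * lucas b n))%Z.
Proof.
elim: n => [|n /dvdzP[d IH]].
  by rewrite lucas0 lucas1 expr0 !mulr0 !addr0 subrr.
apply/dvdzP; exists (q * d - lucas b n); rewrite lucasSS exprS.
have -> : q ^+ n = d * (b * q - q * q - 1) - b * lucas b n
                   + (lucas b n.+1 + q * lucas b n).
  by rewrite -IH; ring.
ring.
Qed.

End LucasExp.

Section ExpModLucas.

Local Open Scope ring_scope.
Local Open Scope nat_scope.

Lemma lucasn_expn_mod b q m n : 2 <= b -> m + q * q + 1 = b * q ->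
  q ^ n + b * lucasn b n = lucasn b n.+1 + q * lucasn b n %[mod m].
Proof.
move=> b2 Em; apply/eqP; rewrite -dvdz_subE !PoszD !PoszM !lucasnE //.
have -> : m%:Z = (b%:Z * q%:Z - q%:Z * q%:Z - 1)%R by clear - Em; lia.
have := dvdz_lucas_exp b q n.
suff -> : (q%:Z ^+ n)%R = Posz (q ^ n) by [].
by elim: n => // n IH; rewrite GRing.exprS IH expnS PoszM.
Qed.

End ExpModLucas.

Lemma expn_leq_lucasn q n : q ^ n <= lucasn (q + 4) n.+1.
Proof.
have b2 : 2 <= q + 4 by lia.
elim: n => [//|n IH].
have := lucasnSS n b2; have := lucasn_ltn b2 (ltnSn n).
rewrite expnS; move: (lucasn _ n) (lucasn _ n.+1) (lucasn _ n.+2) (q ^ n) IH.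
move=> x y z t; nia.
Qed.

(** The base [b] contains a Lucas number that is at least [q ^ n], so the modulus exceeds [q ^ n]
    and the congruence determines the power. *)
Lemma expn_lucas q n p b m : 0 < q -> b = q * q + 2 + lucasn (q + 4) n.+1 ->
  m + q * q + 1 = b * q ->
  (p = q ^ n <-> p < m /\
   p + b * lucasn b n = lucasn b n.+1 + q * lucasn b n %[mod m]).
Proof.
move=> q0 Eb Em.
have b2 : 2 <= b by lia.
have lt : q ^ n < m.
  apply: leq_ltn_trans (expn_leq_lucasn q n) _.
  by move: (lucasn _ _) Eb Em => a -> {b2}; nia.
have E := lucasn_expn_mod n b2 Em.
split=> [-> //|[pm]]; rewrite -E => /eqP; rewrite eqn_modDr => /eqP.
by rewrite !modn_small.
Qed.

Lemma sum_digits_lt (c : nat -> nat) u k : (forall i, c i < u) ->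
  \sum_(i < k) c i * u ^ i < u ^ k.
Proof.
move=> cu; elim: k => [|k IH]; first by rewrite big_ord0.
rewrite big_ord_recr expnS /=.
apply: (@leq_trans (u ^ k + c k * u ^ k)); first by rewrite ltn_add2r.
by rewrite -mulSn leq_mul2r cu orbT.
Qed.

Lemma sum_digits_div (c : nat -> nat) u k d : (forall i, c i < u) ->
  (\sum_(i < k.+1 + d) c i * u ^ i) %/ u ^ k %% u = c k.
Proof.
move=> cu; have u0 : 0 < u by apply: leq_ltn_trans (cu 0).
rewrite big_split_ord big_ord_recr /=.
set lo := (\sum_(i < k) _).
have -> : \sum_(i < d) c (k.+1 + i) * u ^ (k.+1 + i)
  = (\sum_(i < d) c (k.+1 + i) * u ^ i) * u * u ^ k.
  rewrite !big_distrl /=; apply: eq_bigr => i _.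
  by rewrite expnD expnS; lia.
have := sum_digits_lt k cu; rewrite -/lo => lt.
rewrite -addnA -mulnDl addnC divnMDl ?expn_gt0 ?u0 // divn_small // addn0.
by rewrite addnC modnMDl modn_small.
Qed.

(** Binomial coefficients are at most [2 ^ n < u], hence they are the digits of [(1 + u) ^ n] in
    base [u]. *)
Lemma binomial_digit n k u : u = 2 ^ n + 1 ->
  'C(n, k) = ((1 + u) ^ n %/ u ^ k) %% u.
Proof.
move=> Eu.
have lt i : 'C(n, i) < u.
  rewrite Eu addn1 ltnS.
  have -> : 2 ^ n = \sum_(j < n.+1) 'C(n, j).
    rewrite -[2]/(1 + 1) expnDn; apply: eq_bigr => j _.
    by rewrite !exp1n !muln1.
  have [le|gt] := leqP i n; last by rewrite bin_small.
  by rewrite (bigD1 (Ordinal (_ : i < n.+1))) //= leq_addr.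
rewrite -{1}(sum_digits_div k n lt); congr (_ %/ _ %% _).
rewrite expnDn addSnnS addnC big_split_ord /= [X in _ + X]big1 ?addn0.
  by apply: eq_bigr => i _; rewrite exp1n mul1n.
by move=> i _; rewrite bin_small // ltn_addr.
Qed.

Lemma expn_leq_ffact r n : r ^ n <= r ^_ n + n * n * r ^ n.-1.
Proof.
elim: n => [//|[|n] IH]; first by rewrite ffactn1 leq_addr.
rewrite ffactnSr [in X in X <= _]expnSr.
apply: leq_trans (leq_mul IH (leqnn r)) _.
rewrite mulnDl /=.
have : r ^_ n.+1 * r <= r ^_ n.+1 * (r - n.+1) + n.+1 * r ^ n.+1.
  have : r ^_ n.+1 <= r ^ n.+1.
    rewrite ffact_prod; elim: (n.+1) => [|m IHm]; first by rewrite big_ord0.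
    by rewrite big_ord_recr expnSr leq_mul // leq_subr.
  by move: (r ^_ n.+1) (r ^ n.+1) => x y xy; nia.
by rewrite -mulnA -expnSr; move: (r ^ n.+1) (r ^_ n.+1) (r - n.+1) => x y z; nia.
Qed.

Lemma fact_leq_expn n : n`! <= n ^ n.
Proof.
elim: n => [//|n IH]; rewrite factS expnS leq_mul2l /=.
by apply: leq_trans IH _; case: n => [//|n]; rewrite leq_exp2r.
Qed.

(** The quotient of [r ^ n] by ['C(r, n)] is [n!] times the ratio of [r ^ n] to the falling
    factorial. For large [r] that ratio is close enough to 1 for the quotient to stay below
    [n! + 1]. *)
Lemma factorial_digit n r : r = n.+1 ^ n.+2 -> n`! = r ^ n %/ 'C(r, n).
Proof.
case: n => [|n] Er; first by rewrite Er.
(* Two of the factors [n+2] of [r] outweigh the square; the remaining ones outweigh the factorial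
   plus 1. *)
have big : n.+1`! * (n.+1 * n.+1) + n.+1 * n.+1 < r.
  have H : n.+1`! + 1 <= n.+2 ^ n.+1.
    rewrite addn1; apply: leq_ltn_trans (fact_leq_expn _) _.
    by rewrite ltn_exp2r.
  rewrite Er !(expnS _ n.+2) (expnS _ n.+1).
  move: H; move: (n.+2 ^ n.+1) (n.+1`!) => x y; clear; nia.
have le := expn_leq_ffact r n.+1.
have r0 : 0 < r by apply: leq_ltn_trans big.
have ub : r ^_ n.+1 <= r ^ n.+1.
  rewrite ffact_prod -[in X in _ <= X](card_ord n.+1) -prod_nat_const.
  by apply: leq_prod => i _; apply: leq_subr.
have Ebin := bin_ffact r n.+1.
rewrite /= expnS in le ub *; rewrite -Ebin in le ub.
have x0 : 0 < r ^ n by rewrite expn_gt0 r0.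
have f0 := fact_gt0 n.+1.
move: (r ^ n) ('C(r, n.+1)) (n.+1`!) x0 f0 big le ub => x c f x0 f0 big le ub.
have c0 : 0 < c.
  by case: c le ub => // le; nia.
suff H : c * f <= r * x < c * f.+1.
  by apply/esym/eqP; rewrite eqn_leq leq_divRL // -ltnS ltn_divLR // [f * c]mulnC
    [f.+1 * c]mulnC andbC.
rewrite ub /= mulnS addnC.
suff : n.+1 * n.+1 * x < c by move=> H; apply: leq_ltn_trans le _; rewrite ltn_add2l.
rewrite -(ltn_pmul2r f0) -(ltn_add2r (n.+1 * n.+1 * x)).
apply: leq_trans le.
by rewrite mulnAC -mulnDl ltn_pmul2r // [_ * f]mulnC.
Qed.

(** * Diophantine relations *)

Inductive atom (V : Type) :=
| AOne of V
| AAdd of V & V & V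
| AMul of V & V & V.

Arguments AOne {V}.
Arguments AAdd {V}.
Arguments AMul {V}.

Definition holds V (v : V -> nat) (A : atom V) : bool :=
  match A with
  | AOne a => v a == 1
  | AAdd a b c => v a + v b == v c
  | AMul a b c => v a * v b == v c
  end.

Definition map_atom V W (f : V -> W) (A : atom V) : atom W :=
  match A with
  | AOne a => AOne (f a)
  | AAdd a b c => AAdd (f a) (f b) (f c)
  | AMul a b c => AMul (f a) (f b) (f c)
  end.

Definition atom_vars V (A : atom V) : seq V :=
  match A with
  | AOne a => [:: a]
  | AAdd a b c => [:: a; b; c]
  | AMul a b c => [:: a; b; c]
  end.

Definition case_sum A B C (f : A -> C) (g : B -> C) (z : A + B) : C :=
  match z with inl a => f a | inr b => g b end.

Lemma holds_map V W (f : V -> W) v A : holds v (map_atom f A) = holds (v \o f) A.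
Proof. by case: A. Qed.

Lemma eq_holds V (v w : V -> nat) : v =1 w -> holds v =1 holds w.
Proof. by move=> E [a|a b c|a b c] /=; rewrite !E. Qed.

Lemma all_holds_map V W (f : V -> W) v w S : v \o f =1 w ->
  all (holds v) (map (map_atom f) S) = all (holds w) S.
Proof.
move=> E; rewrite all_map; apply: eq_all => A /=.
by rewrite holds_map (eq_holds E).
Qed.

(* The type [X] holds the existentially quantified unknowns. *)
Definition dio V (R : (V -> nat) -> Prop) : Prop :=
  exists (X : Type) (S : seq (atom (V + X))),
    forall v, R v <-> exists x : X -> nat, all (holds (case_sum v x)) S.

Definition dfun V (f : (V -> nat) -> nat) : Prop :=
  dio (fun v : option V -> nat => v None = f (fun a => v (Some a))).

Lemma dio_ext V (R R' : (V -> nat) -> Prop) :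
  (forall v, R' v <-> R v) -> dio R -> dio R'.
Proof. by move=> E [X [S H]]; exists X, S => v; rewrite E H. Qed.

Lemma dio_rename V W (f : W -> V) (R : (W -> nat) -> Prop) :
  dio R -> dio (fun v => R (fun a => v (f a))).
Proof.
move=> [X [S H]].
exists X, [seq map_atom (case_sum (inl \o f) inr) A | A <- S] => v; rewrite H.
by split=> -[x Hx]; exists x; move: Hx; rewrite (@all_holds_map _ _ _ _
  (case_sum (fun a => v (f a)) x)) //; case.
Qed.

Lemma dio_and V (R1 R2 : (V -> nat) -> Prop) :
  dio R1 -> dio R2 -> dio (fun v => R1 v /\ R2 v).
Proof.
move=> [X1 [S1 H1]] [X2 [S2 H2]].
exists (X1 + X2)%type,
  (map (map_atom (case_sum inl (inr \o inl))) S1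
   ++ map (map_atom (case_sum inl (inr \o inr))) S2) => v.
rewrite H1 H2; split=> [[[x1 E1] [x2 E2]]|[x]].
  exists (case_sum x1 x2); rewrite all_cat.
  rewrite (@all_holds_map _ _ _ _ (case_sum v x1)); last by case.
  by rewrite (@all_holds_map _ _ _ _ (case_sum v x2)) ?E1 //; case.
rewrite all_cat => /andP[].
rewrite (@all_holds_map _ _ _ _ (case_sum v (x \o inl))); last by case.
rewrite (@all_holds_map _ _ _ _ (case_sum v (x \o inr))); last by case.
by split; [exists (x \o inl)|exists (x \o inr)].
Qed.

(** [W] may be infinite: a system is a finite list, so it constrains only finitely many of the
    values of [w]. *)
Lemma dio_exfun V W (R : (V -> nat) -> (W -> nat) -> Prop) :
  dio (fun v : V + W -> nat => R (fun a => v (inl a)) (fun b => v (inr b))) ->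
  dio (fun v => exists w, R v w).
Proof.
move=> [X [S H]].
exists (W + X)%type, (map (map_atom
  (case_sum (case_sum inl (inr \o inl)) (inr \o inr))) S) => v.
split=> [[w]|[x]].
  rewrite (H (case_sum v w)) => -[x Hx]; exists (case_sum w x).
  by rewrite (@all_holds_map _ _ _ _ (case_sum (case_sum v w) x)) // => -[[]|].
rewrite (@all_holds_map _ _ _ _
  (case_sum (case_sum v (x \o inl)) (x \o inr))); last by case=> [[]|].
by move=> Hx; exists (x \o inl); apply/(H (case_sum v (x \o inl))); exists (x \o inr).
Qed.

Lemma dio_ex V (R : (V -> nat) -> nat -> Prop) :
  dio (fun v : option V -> nat => R (fun a => v (Some a)) (v None)) ->
  dio (fun v => exists x, R v x).
Proof.
move=> H; apply: (@dio_ext _ (fun v => exists w : unit -> nat, R v (w tt))).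
  by move=> v; split=> [[x Hx]|[w Hw]]; [exists (fun _ => x)|exists (w tt)].
apply: dio_exfun.
exact: (dio_rename (fun z => if z is Some a then inl a else inr tt) H).
Qed.

Lemma dio_true V (P : Prop) : P -> dio (fun _ : V -> nat => P).
Proof. by move=> HP; exists unit, [::] => v; split=> // _; exists (fun _ => 0). Qed.

Lemma dio_all_in V (I : eqType) (s : seq I) (R : I -> (V -> nat) -> Prop) :
  (forall i, i \in s -> dio (R i)) -> dio (fun v => forall i, i \in s -> R i v).
Proof.
elim: s => [_|i s IH H].
  by apply: (@dio_ext _ (fun _ => True)); [|exact: dio_true].
apply: (@dio_ext _ (fun v => R i v /\ forall i, i \in s -> R i v)).
  move=> v; split=> [Hv|[Hi Hs] j]; last by rewrite inE => /orP[/eqP->|/Hs].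
  by split=> [|j js]; apply: Hv; rewrite inE ?eqxx ?js ?orbT.
apply: dio_and; first by apply: H; rewrite inE eqxx.
by apply: IH => j js; apply: H; rewrite inE js orbT.
Qed.

Lemma dio_all V (I : finType) (R : I -> (V -> nat) -> Prop) :
  (forall i, dio (R i)) -> dio (fun v => forall i, R i v).
Proof.
move=> H; apply: (@dio_ext _ (fun v => forall i, i \in enum I -> R i v)).
  by move=> v; split=> Hv i; [move=> _|]; apply: Hv; rewrite ?mem_enum.
by apply: dio_all_in.
Qed.

Lemma dfun_rename V W (f : W -> V) (F : (W -> nat) -> nat) :
  dfun F -> dfun (fun v => F (fun a => v (f a))).
Proof. exact: (dio_rename (option_map f)). Qed.

Lemma dio_comp V (W : finType) (f : W -> (V -> nat) -> nat)
    (R : (W -> nat) -> Prop) :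
  dio R -> (forall i, dfun (f i)) -> dio (fun v => R (fun i => f i v)).
Proof.
move=> HR Hf.
apply: (@dio_ext _ (fun v => exists w : W -> nat, R w /\ forall i, w i = f i v)).
  move=> v; split=> [Hv|[w [Hw E]]]; first by exists (fun i => f i v).
  by have <- : w = (fun i => f i v) by apply/funext.
apply/dio_exfun/dio_and; first exact: (dio_rename inr HR).
apply: dio_all => i.
exact: (dio_rename (fun z => if z is Some a then inl a else inr i) (Hf i)).
Qed.

Lemma dfun_var V (a : V) : dfun (fun v => v a).
Proof.
(* Atoms offer no plain equality; it is expressed as a product with an unknown equal to 1. *)
exists unit, [:: AOne (inr tt); AMul (inl None) (inr tt) (inl (Some a))] => v.
split=> [E|[x]]; first by exists (fun _ => 1); rewrite /= E muln1 eqxx.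
by rewrite /= andbT => /andP[/eqP->]; rewrite muln1 => /eqP.
Qed.

Lemma dio_eq V (f g : (V -> nat) -> nat) :
  dfun f -> dfun g -> dio (fun v => f v = g v).
Proof.
move=> Hf Hg.
apply: (@dio_ext _ (fun v => exists x, x = f v /\ x = g v)).
  by move=> v; split=> [E|[x [<-]]] //; exists (f v).
by apply/dio_ex/dio_and.
Qed.

Lemma dio_comp2 V (P : nat -> nat -> Prop) (f g : (V -> nat) -> nat) :
  dio (fun v : bool -> nat => P (v true) (v false)) -> dfun f -> dfun g ->
  dio (fun v => P (f v) (g v)).
Proof.
by move=> H Hf Hg; apply: (dio_comp (f := fun b => if b then f else g) H); case.
Qed.

Lemma dio_comp3 V (P : nat -> nat -> nat -> Prop) (f g h : (V -> nat) -> nat) :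
  dio (fun v : option bool -> nat => P (v (Some true)) (v (Some false)) (v None)) ->
  dfun f -> dfun g -> dfun h -> dio (fun v => P (f v) (g v) (h v)).
Proof.
move=> H Hf Hg Hh.
apply: (dio_comp (f := fun b => match b with
  Some true => f | Some false => g | None => h end) H).
by case=> [[]|].
Qed.

Lemma dfun_comp1 V (F : nat -> nat) (f : (V -> nat) -> nat) :
  dio (fun v : bool -> nat => v true = F (v false)) -> dfun f ->
  dfun (fun v => F (f v)).
Proof.
move=> H Hf; apply: (dio_comp2 (P := fun x y => x = F y) H).
  exact: dfun_var.
exact: (dfun_rename Some Hf).
Qed.

Lemma dfun_comp2 V (F : nat -> nat -> nat) (f g : (V -> nat) -> nat) :
  dio (fun v : option bool -> nat => v (Some true) = F (v (Some false)) (v None)) ->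
  dfun f -> dfun g -> dfun (fun v => F (f v) (g v)).
Proof.
move=> H Hf Hg; apply: (dio_comp3 (P := fun x y z => x = F y z) H).
- exact: dfun_var.
- exact: (dfun_rename Some Hf).
- exact: (dfun_rename Some Hg).
Qed.

Lemma dfun_add V (f g : (V -> nat) -> nat) :
  dfun f -> dfun g -> dfun (fun v => f v + g v).
Proof.
apply: (@dfun_comp2 _ addn); exists void.
exists [:: AAdd (inl (Some false)) (inl None) (inl (Some true))] => v.
split=> [E|[x]] /=; first by exists (fun x : void => match x with end); rewrite E eqxx.
by rewrite andbT => /eqP.
Qed.

Lemma dfun_mul V (f g : (V -> nat) -> nat) :
  dfun f -> dfun g -> dfun (fun v => f v * g v).
Proof.
apply: (@dfun_comp2 _ muln); exists void.
exists [:: AMul (inl (Some false)) (inl None) (inl (Some true))] => v.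
split=> [E|[x]] /=; first by exists (fun x : void => match x with end); rewrite E eqxx.
by rewrite andbT => /eqP.
Qed.

Lemma dfun_one V : dfun (fun _ : V -> nat => 1).
Proof.
exists void, [:: AOne (inl None)] => v.
split=> [E|[x]] /=; first by exists (fun x : void => match x with end); rewrite E eqxx.
by rewrite andbT => /eqP.
Qed.

Lemma dfun_zero V : dfun (fun _ : V -> nat => 0).
Proof.
exists void, [:: AAdd (inl None) (inl None) (inl None)] => v.
split=> [E|[x]] /=; first by exists (fun x : void => match x with end); rewrite E eqxx.
by rewrite andbT => /eqP/=; lia.
Qed.

Lemma dfun_const V n : dfun (fun _ : V -> nat => n).
Proof.
elim: n => [|n IH]; first exact: dfun_zero.
by have := dfun_add IH (dfun_one V); rewrite /dfun addn1.
Qed.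

Lemma dfun_succ V (f : (V -> nat) -> nat) : dfun f -> dfun (fun v => (f v).+1).
Proof.
move=> Hf; have := dfun_add Hf (dfun_one V).
by congr dfun; apply: funext => v; rewrite addn1.
Qed.

(** A hook, rebound whenever further operations or relations are shown to be Diophantine, so that
    [dio_step] follows the shape of larger expressions. *)
Ltac dio_more := fail.

Ltac dio_step := cbv beta zeta; first [dio_more | lazymatch goal with
  | H : dfun ?f |- dfun ?f => exact H
  | H : dio ?f |- dio ?f => exact H
  | |- dfun (fun _ => ?n) => exact: dfun_const
  | |- dfun (fun v => v _) => exact: dfun_var
  | |- dfun (fun v => @?f v + @?g v) => apply: (@dfun_add _ f g)
  | |- dfun (fun v => @?f v * @?g v) => apply: (@dfun_mul _ f g)
  | |- dfun (fun v => (@?f v).+1) => apply: (@dfun_succ _ f)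
  | |- dio (fun v => @?f v /\ @?g v) => apply: (@dio_and _ f g)
  | |- dio (fun v => exists x, @?R v x) => apply: (@dio_ex _ R)
  | |- dio (fun v => @?f v = @?g v) => apply: (@dio_eq _ f g)
  end].

Lemma dio_le V (f g : (V -> nat) -> nat) :
  dfun f -> dfun g -> dio (fun v => f v <= g v).
Proof.
apply: (@dio_comp2 _ (fun x y => x <= y)).
apply: (@dio_ext _ (fun v => exists x, v true + x = v false)).
  by move=> v; split=> [/subnKC|[x <-]]; [exists (v false - v true)|apply: leq_addr].
by repeat dio_step.
Qed.

(** A multiple of the modulus is added on each side, so neither the sign of the difference nor a
    zero modulus needs a separate case. *)
Lemma dio_modeq V (f g d : (V -> nat) -> nat) :
  dfun f -> dfun g -> dfun d -> dio (fun v => f v = g v %[mod d v]).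
Proof.
apply: (@dio_comp3 _ (fun x y d => x = y %[mod d])).
apply: (@dio_ext _ (fun v => exists p q, p * v None + v (Some true)
   = q * v None + v (Some false))).
  move=> v; split=> [E|[p [q E]]].
    exists (v (Some false) %/ v None), (v (Some true) %/ v None).
    have := divn_eq (v (Some true)) (v None).
    have := divn_eq (v (Some false)) (v None).
    rewrite E; move: (_ %/ _) (_ %/ _) (_ %% _) => p q r; clear; lia.
  by rewrite -(modnMDl p) E modnMDl.
by repeat dio_step.
Qed.

Ltac dio_order := lazymatch goal with
  | |- dio (fun v => is_true (@?f v <= @?g v)) => apply: (@dio_le _ f g)
  | |- dio (fun v => @?f v = @?g v %[mod @?d v]) => apply: (@dio_modeq _ f g d)
  end.
Ltac dio_more ::= dio_order.

Lemma dio_dvd V (f g : (V -> nat) -> nat) :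
  dfun f -> dfun g -> dio (fun v => f v %| g v).
Proof.
apply: (@dio_comp2 _ (fun x y => x %| y)).
apply: (@dio_ext _ (fun v => exists q, v false = q * v true)).
  by move=> v; split=> /dvdnP.
by repeat dio_step.
Qed.

(** The offset 4 builds the hypothesis [4 <= b] of [lucas_system] into the term. *)
Lemma dfun_lucasn V (f g : (V -> nat) -> nat) :
  dfun f -> dfun g -> dfun (fun v => lucasn (f v + 4) (g v)).
Proof.
apply: (@dfun_comp2 _ (fun b c => lucasn (b + 4) c)).
apply: (@dio_ext _ (fun v => exists u t s r vv w x y,
  lucas_system (v (Some false) + 4) (v None) (v (Some true)) u t s r vv w x y)).
  move=> v; split=> [->|]; first by apply: lucas_system_complete; rewrite leq_addl.
  move=> [u [t [s [r [vv [w [x [y]]]]]]]].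
  by apply: lucas_system_sound; rewrite leq_addl.
do 8!(apply: dio_ex; cbv beta).
apply: (@dio_ext _ (fun v : option (option (option (option (option (option
   (option (option (option bool)))))))) -> nat =>
   let: y := v None in
   let: x := v (Some None) in
   let: w := v (Some (Some None)) in
   let: vv := v (Some (Some (Some None))) in
   let: r := v (Some (Some (Some (Some None)))) in
   let: s := v (Some (Some (Some (Some (Some None))))) in
   let: t := v (Some (Some (Some (Some (Some (Some None)))))) in
   let: u := v (Some (Some (Some (Some (Some (Some (Some None))))))) in
   let: c := v (Some (Some (Some (Some (Some (Some (Some (Some None)))))))) in
   let: a := v (Some (Some (Some (Some (Some (Some (Some (Some (Some true))))))))) in
   let: b := v (Some (Some (Some (Some (Some (Some (Some (Some (Some false))))))))) + 4 in
      (u * u + t * t = b * u * t + 1 /\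
      s * s + r * r = b * s * r + 1 /\
      x * x + y * y = w * x * y + 1 /\ b <= w) /\
      (r < s /\ (exists q, s = q * (u * u)) /\ vv + 2 * r = b * s /\
      w = b %[mod vv] /\ w = 2 %[mod u]) /\
      (2 * a < u /\ 2 * a < vv /\ x = a %[mod vv])
    /\ 2 * c < u /\ x = c %[mod u])).
  move=> v; split.
    by move=> [[? ? ? ?] [? /dvdnP ? ? ? ?] [? ? ?] [? ?]].
  by move=> [[? [? [? ?]]] [[? [/dvdnP ? [? [? ?]]]] [[? [? ?]] [? ?]]]].
by repeat dio_step.
Qed.

Ltac dio_lucas := first [dio_order | lazymatch goal with
  | |- dio (fun v => is_true (@?f v %| @?g v)) => apply: (@dio_dvd _ f g)
  | |- dfun (fun v => lucasn (@?f v + 4) (@?g v)) => apply: (@dfun_lucasn _ f g)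
  end].
Ltac dio_more ::= dio_lucas.

Lemma dfun_expn V (f g : (V -> nat) -> nat) :
  dfun f -> dfun g -> dfun (fun v => (f v).+1 ^ g v).
Proof.
apply: (@dfun_comp2 _ (fun q n => q.+1 ^ n)).
pose sys (p q n b m : nat) := b + 4 = q * q + 2 + lucasn (q + 4) n.+1 /\
  m + q * q + 1 = (b + 4) * q /\ p < m /\
  p + (b + 4) * lucasn (b + 4) n
    = lucasn (b + 4) n.+1 + q * lucasn (b + 4) n %[mod m].
apply: (@dio_ext _ (fun v => exists b m,
   sys (v (Some true)) (v (Some false)).+1 (v None) b m)).
  move=> v; move: (v (Some true)) (v (Some false)) (v None) => p q n; split.
    (* The unknown stands for the base minus 4, to match the form [lucasn (b + 4)]; the sum is at
       least 4, so the subtraction is exact. *)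
    move=> Ep; exists (q.+1 * q.+1 + 2 + lucasn (q.+1 + 4) n.+1 - 4).
    have l1 : 0 < lucasn (q.+1 + 4) n.+1.
      by apply: leq_trans (expn_leq_lucasn _ _); rewrite expn_gt0.
    have -> : q.+1 * q.+1 + 2 + lucasn (q.+1 + 4) n.+1 - 4 =
       (q * q + 2 * q + lucasn (q.+1 + 4) n.+1).-1 by lia.
    set b := _.-1; have Eb : b + 4 = q.+1 * q.+1 + 2 + lucasn (q.+1 + 4) n.+1.
      by rewrite /b; lia.
    have Em : (b + 4) * q.+1 - q.+1 * q.+1 - 1 + q.+1 * q.+1 + 1 = (b + 4) * q.+1.
      have : q.+1 * q.+1 + 1 <= (b + 4) * q.+1 by rewrite Eb; clear; nia.
      by move: (_ * _) ((b + 4) * _); lia.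
    exists ((b + 4) * q.+1 - q.+1 * q.+1 - 1); do 2!split=> //.
    by apply/(expn_lucas _ _ Eb Em).
  by move=> [b [m [Eb [Em H]]]]; apply/(expn_lucas _ _ Eb Em).
rewrite /sys; by repeat dio_step.
Qed.

Lemma eq_divn q m d : 0 < d -> q = m %/ d <-> q * d <= m /\ m < q.+1 * d.
Proof.
move=> d0; rewrite -leq_divRL // -ltn_divLR // ltnS.
by split=> [->//|[le1 le2]]; apply/eqP; rewrite eqn_leq le1.
Qed.

Ltac dio_exp := first [dio_lucas | lazymatch goal with
  | |- dfun (fun v => (@?f v).+1 ^ (@?g v)) => apply: (@dfun_expn _ f g)
  end].
Ltac dio_more ::= dio_exp.

Lemma dfun_binomial V (f g : (V -> nat) -> nat) :
  dfun f -> dfun g -> dfun (fun v => 'C(f v, g v)).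
Proof.
apply: (@dfun_comp2 _ binomial).
pose sys (x n k u d : nat) := u = 2 ^ n /\
  (d * u.+1 ^ k <= u.+2 ^ n /\ u.+2 ^ n < d.+1 * u.+1 ^ k) /\
  x < u.+1 /\ x = d %[mod u.+1].
apply: (@dio_ext _ (fun v => exists u d,
   sys (v (Some true)) (v (Some false)) (v None) u d)).
  move=> v; move: (v (Some true)) (v (Some false)) (v None) => x n k.
  rewrite (binomial_digit k (erefl (2 ^ n + 1))) addn1 add1n.
  split=> [->|[u [d [-> [H [xu E]]]]]].
    exists (2 ^ n), ((2 ^ n).+2 ^ n %/ (2 ^ n).+1 ^ k); split=> //.
    by split; [apply/eq_divn => //; rewrite expn_gt0|rewrite ltn_mod modn_mod].
  have <- : d = (2 ^ n).+2 ^ n %/ (2 ^ n).+1 ^ k by apply/eq_divn; rewrite // expn_gt0.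
  by rewrite -E modn_small.
rewrite /sys; by repeat dio_step.
Qed.

Ltac dio_binomial := first [dio_exp | lazymatch goal with
  | |- dfun (fun v => 'C(@?f v, @?g v)) => apply: (@dfun_binomial _ f g)
  end].
Ltac dio_more ::= dio_binomial.

Lemma dfun_factorial V (f : (V -> nat) -> nat) :
  dfun f -> dfun (fun v => (f v)`!).
Proof.
apply: (@dfun_comp1 _ factorial).
pose sys (x n r : nat) := r.+1 = n.+1 ^ n.+2 /\
  x * 'C(r.+1, n) <= r.+1 ^ n /\ r.+1 ^ n < x.+1 * 'C(r.+1, n).
apply: (@dio_ext _ (fun v => exists r, sys (v true) (v false) r)).
  move=> v; move: (v true) (v false) => x n.
  have Er : (n.+1 ^ n.+2).-1.+1 = n.+1 ^ n.+2 by rewrite prednK // expn_gt0.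
  have c0 : 0 < 'C((n.+1 ^ n.+2).-1.+1, n).
    rewrite bin_gt0 Er; apply: leq_trans (leqnSn n) _.
    by rewrite -[X in X <= _]expn1 leq_pexp2l.
  rewrite (factorial_digit (erefl (n.+1 ^ n.+2))) -Er eq_divn //.
  split=> [H|[r [E H]]]; first by exists (n.+1 ^ n.+2).-1.
  by move: E H; rewrite -Er => -[->].
rewrite /sys; by repeat dio_step.
Qed.

Ltac dio_factorial := first [dio_binomial | lazymatch goal with
  | |- dfun (fun v => (@?f v)`!) => apply: (@dfun_factorial _ f)
  end].
Ltac dio_more ::= dio_factorial.

(** * Coding of finite sequences by residues *)

(** Thanks to the square, the quotient by any [k+1 <= z] is still a multiple of [z!]. All moduli
    with [k < z] are then 1 modulo [z!], and all their prime factors exceed [z]. *)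
Definition beta_base (z : nat) : nat := z`! * z`!.
Definition beta_mod (T k : nat) : nat := (T %/ k.+1).+1.

Lemma beta_modE z k : k < z -> exists c, beta_mod (beta_base z) k = (z`! * c).+1.
Proof.
move=> kz; exists (z`! %/ k.+1).
by rewrite /beta_mod /beta_base muln_divA // dvdn_fact.
Qed.

Lemma beta_mod_mul z k : k < z ->
  beta_mod (beta_base z) k * k.+1 = beta_base z + k.+1.
Proof.
move=> kz; rewrite /beta_mod mulSn divnK 1?addnC //.
by apply: dvdn_mulr; rewrite dvdn_fact.
Qed.

(** Modulo the [k]-th modulus, [k] is minus [beta_base z + 1], an expression free of [k]. One
    divisibility by the product of the moduli can therefore say that a number has residue [k] at
    every place. *)
Lemma dvdn_beta_mod z k : k < z ->
  beta_mod (beta_base z) k %| beta_base z + k.+1.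
Proof. by move=> /beta_mod_mul <-; apply: dvdn_mulr. Qed.

Lemma coprime_beta_mod_fact z k : k < z -> coprime (beta_mod (beta_base z) k) z`!.
Proof.
move=> /beta_modE[c ->]; rewrite coprime_sym -addn1.
by rewrite /coprime mulnC gcdnMDl gcdn1.
Qed.

Lemma prime_dvd_beta_mod p z k : k < z -> prime p ->
  p %| beta_mod (beta_base z) k -> z < p.
Proof.
move=> kz pp pm; rewrite ltnNge; apply/negP => pz.
have pf : p %| z`! by rewrite dvdn_fact // prime_gt0.
have := coprime_dvdl pm (coprime_dvdr pf (coprime_beta_mod_fact kz)).
by rewrite /coprime gcdnn => /eqP p1; rewrite p1 in pp.
Qed.

(** A common prime factor would exceed [z] and divide the difference of the two multiples
    [beta_base z + k + 1] and [beta_base z + j + 1], which is [k - j < z]. *)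
Lemma coprime_beta_mod z j k : j < k -> k < z ->
  coprime (beta_mod (beta_base z) j) (beta_mod (beta_base z) k).
Proof.
move=> jk kz; have jz := ltn_trans jk kz.
rewrite /coprime; apply/negPn/negP => g1.
set g := gcdn _ _ in g1.
have [gj gk] : g %| beta_mod (beta_base z) j /\ g %| beta_mod (beta_base z) k.
  by rewrite /g dvdn_gcdl dvdn_gcdr.
have g0 : 0 < g by rewrite gcdn_gt0.
have pp : prime (pdiv g) by apply: pdiv_prime; rewrite ltn_neqAle eq_sym g1.
have pz := prime_dvd_beta_mod jz pp (dvdn_trans (pdiv_dvd g) gj).
have : pdiv g %| (beta_base z + k.+1) - (beta_base z + j.+1).
  apply: dvdn_sub; apply: dvdn_trans (pdiv_dvd g) _.
    exact: dvdn_trans gk (dvdn_beta_mod kz).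
  exact: dvdn_trans gj (dvdn_beta_mod jz).
have -> : (beta_base z + k.+1) - (beta_base z + j.+1) = k - j.
  by rewrite subnDl subSS.
by move=> /dvdn_leq; rewrite subn_gt0 => /(_ jk); lia.
Qed.

Lemma prod_beta_mod z y : y <= z ->
  \prod_(k < y) beta_mod (beta_base z) k = 'C(beta_base z + y, y).
Proof.
elim: y => [|y IH] yz; first by rewrite big_ord0 bin0.
rewrite big_ord_recr /= IH; last exact: ltnW.
apply/eqP; rewrite -(eqn_pmul2l (ltn0Sn y)) addnS -mul_bin_diag /=.
by rewrite -addnS -beta_mod_mul //; apply/eqP; lia.
Qed.

Lemma coprime_prod_beta_mod z y k : y <= k -> k < z ->
  coprime (\prod_(j < y) beta_mod (beta_base z) j) (beta_mod (beta_base z) k).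
Proof.
move=> yk kz; elim: y yk => [|y IH] yk; first by rewrite big_ord0 coprime1n.
by rewrite big_ord_recr coprimeMl IH 1?ltnW //= coprime_beta_mod.
Qed.

Lemma dvdn_bin_beta z y x : y <= z ->
  (forall k, k < y -> beta_mod (beta_base z) k %| x) ->
  'C(beta_base z + y, y) %| x.
Proof.
move=> yz; rewrite -prod_beta_mod //.
elim: y yz => [|y IH] yz H; first by rewrite big_ord0.
rewrite big_ord_recr Gauss_dvd ?coprime_prod_beta_mod // H // IH 1?ltnW //.
by move=> k ky; apply: H; apply: ltnW.
Qed.

Lemma beta_mod_dvd_bin z y k : y <= z -> k < y ->
  beta_mod (beta_base z) k %| 'C(beta_base z + y, y).
Proof.
move=> yz ky; rewrite -prod_beta_mod //.
by rewrite (bigD1 (Ordinal ky)) //= dvdn_mulr.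
Qed.

Lemma eq_mod_bin_beta z y a b : y <= z ->
  (forall k, k < y -> a = b %[mod beta_mod (beta_base z) k]) ->
  a = b %[mod 'C(beta_base z + y, y)].
Proof.
move=> yz; wlog le : a b / a <= b => [W H|H].
  by have [|/ltnW] := leqP a b => /W; [apply|move=> E; apply/esym/E => k /H].
apply/esym/eqP; rewrite eqn_mod_dvd //; apply: dvdn_bin_beta => // k ky.
by rewrite -eqn_mod_dvd //; apply/eqP/esym/H.
Qed.

Lemma beta_exists z y (s : nat -> nat) : y <= z ->
  exists x, forall k, k < y -> x = s k %[mod beta_mod (beta_base z) k].
Proof.
elim: y => [|y IH] yz; first by exists 0.
have [x Hx] := IH (ltnW yz).
have cop := coprime_prod_beta_mod (leqnn y) yz.
exists (chinese (\prod_(j < y) beta_mod (beta_base z) j)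
                (beta_mod (beta_base z) y) x (s y)) => k.
rewrite ltnS leq_eqVlt => /orP[/eqP->|ky]; first exact: chinese_modr.
rewrite -Hx //.
have dv : beta_mod (beta_base z) k %| \prod_(j < y) beta_mod (beta_base z) j.
  by rewrite (bigD1 (Ordinal ky)) //= dvdn_mulr.
by rewrite -(modn_dvdm _ dv) chinese_modl // modn_dvdm.
Qed.

Lemma dvdn_ffact d t r m : r < m -> t = r %[mod d] -> d %| t ^_ m.
Proof.
move=> rm E; rewrite ffact_prod (bigD1 (Ordinal rm)) //= dvdn_mulr //.
(* For [t < r] the truncated factor [t - r] is 0. *)
have [lt|le] := ltnP t r; first by rewrite (eqP (_ : t - r == 0)) ?subn_eq0 1?ltnW.
by rewrite -eqn_mod_dvd //; apply/eqP.
Qed.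

Lemma fact_dvd_fact m n : m <= n -> m`! %| n`!.
Proof. by move=> mn; rewrite -(bin_fact mn) dvdn_mull // dvdn_mulr. Qed.

(** With its partial converse [prime_dvd_binomial_mod], this turns a bound on residues into a
    divisibility: the falling factorial contains the factor [t - r], and [m!] is prime to the
    modulus. *)
Lemma beta_mod_dvd_binomial z k t r m : k < z -> r < m -> m <= z ->
  t = r %[mod beta_mod (beta_base z) k] -> beta_mod (beta_base z) k %| 'C(t, m).
Proof.
move=> kz rm mz /(dvdn_ffact rm); rewrite -bin_ffact Gauss_dvdl //.
exact: coprime_dvdr (fact_dvd_fact mz) (coprime_beta_mod_fact kz).
Qed.

Lemma prime_dvd_ffact p t m : prime p -> p %| t ^_ m -> exists2 r, r < m & p %| t - r.
Proof.
move=> pp; rewrite ffact_prod; elim: m => [|m IH].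
  by rewrite big_ord0 dvdn1 => /eqP p1; rewrite p1 in pp.
rewrite big_ord_recr /= Euclid_dvdM // => /orP[/IH[r rm H]|H].
  by exists r => //; apply: ltnW.
by exists m.
Qed.

(** A prime divides one single factor [t - r] with [r <= m], whereas a composite modulus could
    spread over several factors. *)
Lemma prime_dvd_binomial_mod p t m : prime p -> m < p ->
  p %| 'C(t, m.+1) -> t %% p <= m.
Proof.
move=> pp mp pC.
have [lt|le] := ltnP t m.+1; first by apply: leq_trans (leq_mod _ _) _.
have : p %| t ^_ m.+1 by rewrite -bin_ffact dvdn_mulr.
move=> /(prime_dvd_ffact pp)[r rm].
have rt : r <= t by apply: ltnW; apply: leq_trans le.
rewrite -eqn_mod_dvd // => /eqP->.
by apply: leq_trans (leq_mod _ _) _.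
Qed.

(** * Bounded universal quantification *)

(** Recursion on the list instead of membership: the types of variables have no decidable
    equality. *)
Definition All T (P : T -> Prop) (s : seq T) : Prop :=
  foldr (fun a Q => P a /\ Q) True s.

Lemma AllE T (p : pred T) s : all p s <-> All p s.
Proof.
elim: s => [//|a s IH] /=; split=> [/andP[-> /IH]//|[-> H]] /=.
exact/IH.
Qed.

Lemma All_impl T (P Q : T -> Prop) s :
  (forall a, P a -> Q a) -> All P s -> All Q s.
Proof. by move=> PQ; elim: s => [//|a s IH] /= [/PQ Qa /IH]. Qed.

Lemma All_and T (P Q : T -> Prop) s :
  All P s -> All Q s -> All (fun a => P a /\ Q a) s.
Proof. by elim: s => [//|a s IH] /= [Pa Ps] [Qa Qs]; split=> //; apply: IH. Qed.

Lemma All_forall T I (P : I -> T -> Prop) s :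
  (forall i, All (P i) s) -> All (fun a => forall i, P i a) s.
Proof.
elim: s => [//|a s IH] H /=; split=> [i|]; first by have [] := H i.
by apply: IH => i; have [] := H i.
Qed.

Lemma All_leq_sum T (g : T -> nat) s :
  All (fun a => g a <= \sum_(a <- s) g a) s.
Proof.
suff H B : \sum_(a <- s) g a <= B -> All (fun a => g a <= B) s by apply: H.
elim: s => [//|a s IH] /=; rewrite big_cons => le.
by split; [|apply: IH]; apply: leq_trans le; [apply: leq_addr|apply: leq_addl].
Qed.

Lemma dio_All V T (R : T -> (V -> nat) -> Prop) s :
  (forall a, dio (R a)) -> dio (fun v => All (fun a => R a v) s).
Proof.
move=> H; elim: s => [|a s IH] /=; first exact: dio_true.
exact: dio_and.
Qed.

Section BoundedForall.

Variables V X : Type.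

Notation var := (option V + X)%type.

Definition holds_mod (M : nat) (v : var -> nat) (A : atom var) : Prop :=
  match A with
  | AOne a => v a = 1 %[mod M]
  | AAdd a b c => v a + v b = v c %[mod M]
  | AMul a b c => v a * v b = v c %[mod M]
  end.

(* Truth of an atom for every index [k < y] becomes one congruence modulo the
   product [M] of the moduli; the residue of the number [K] modulo the [k]-th
   one is [k]. *)
Definition fuse (u : V -> nat) (K : nat) (t : X -> nat) (a : var) : nat :=
  match a with
  | inl (Some b) => u b
  | inl None => K
  | inr x => t x
  end.

(** For an unknown, divisibility by the product [M] bounds its residues at all places at once. The
    index gets no condition, since [k < y <= B]. *)
Definition fuse_bound (B M : nat) (u : V -> nat) (t : X -> nat) (a : var) : Prop :=
  match a with
  | inl (Some b) => u b <= B
  | inl None => True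
  | inr x => M %| 'C(t x, B.+1)
  end.

(** Large enough to dominate [B + B], [B * B] and [B + 1]: modulo a prime above it, congruent sums
    or products of numbers up to [B] are equal. *)
Definition ball_base (B : nat) : nat := B * B + 2 * B + 1.
Definition ball_prod (B y : nat) : nat := 'C(beta_base (ball_base B) + y, y).

Definition ball_atom (B K y : nat) (u : V -> nat) (t : X -> nat) (A : atom var) :=
  All (fuse_bound B (ball_prod B y) u t) (atom_vars A)
  /\ holds_mod (ball_prod B y) (fuse u K t) A.

Definition at_index (u : V -> nat) (k : nat) (a : option V) : nat :=
  if a is Some b then u b else k.

(** For each [k], one prime factor [p] of the [k]-th modulus suffices: the residues of [t] modulo
    [p] are at most [B], and the congruences between such small numbers are equalities. *)
Lemma ball_sound (S : seq (atom var)) (u : V -> nat) y B K t :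
  y <= B -> ball_prod B y %| K + (beta_base (ball_base B)).+1 ->
  All (ball_atom B K y u t) S ->
  forall k, k < y -> exists x, all (holds (case_sum (at_index u k) x)) S.
Proof.
move=> yB MK HS k ky.
have yz : y <= ball_base B by rewrite /ball_base; lia.
have kz := leq_trans ky yz.
set m := beta_mod (beta_base (ball_base B)) k.
have mM : m %| ball_prod B y by apply: beta_mod_dvd_bin.
have pp : prime (pdiv m).
  apply: pdiv_prime; rewrite /m /beta_mod ltnS divn_gt0 //.
  apply: (@leq_trans (ball_base B)`!); last by rewrite leq_pmulr // fact_gt0.
  by apply: dvdn_leq; [apply: fact_gt0|apply: dvdn_fact].
have pz : ball_base B < pdiv m by apply: (prime_dvd_beta_mod kz pp); apply: pdiv_dvd.
have pM : pdiv m %| ball_prod B y by apply: dvdn_trans mM; apply: pdiv_dvd.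
set p := pdiv m in pp pz pM.
have Bp : B < p by apply: leq_ltn_trans pz; rewrite /ball_base; lia.
have BBp : B + B < p by apply: leq_ltn_trans pz; rewrite /ball_base; lia.
have B2p : B * B < p by apply: leq_ltn_trans pz; rewrite /ball_base; lia.
pose x a := t a %% p; exists x.
pose e := case_sum (at_index u k) x.
have He a : fuse_bound B (ball_prod B y) u t a ->
    fuse u K t a = e a %[mod p] /\ e a <= B.
  rewrite /e; case: a => [[b|]|a] /=; first by [].
    move=> _; split; last by apply: ltnW; apply: leq_trans yB.
    (* Both [K] and [k] become 0 modulo [p] once [beta_base + 1] is added. *)
    apply/eqP; rewrite -(eqn_modDr (beta_base (ball_base B)).+1).
    apply/eqP; transitivity 0.
      by apply/eqP; apply: dvdn_trans MK.
    apply/esym/eqP; apply: dvdn_trans (pdiv_dvd m) _.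
    by rewrite addnS addnC -addnS; apply: dvdn_beta_mod.
  move=> H; rewrite /x modn_mod; split=> //.
  by apply: prime_dvd_binomial_mod => //; apply: dvdn_trans H.
apply/AllE; apply: All_impl HS => A; rewrite /ball_atom.
case: A => [a|a b c|a b c] /= [].
- move=> [/He[Ea la] _] H; apply/eqP.
  have := modn_dvdm (fuse u K t a) pM; rewrite H modn_dvdm // Ea.
  by rewrite !modn_small ?prime_gt1 ?(leq_ltn_trans la Bp) // => <-.
- move=> [/He[Ea la] [/He[Eb lb] [/He[Ec lc] _]]] H; apply/eqP.
  have := modn_dvdm (fuse u K t a + fuse u K t b) pM; rewrite H modn_dvdm //.
  rewrite -modnDm Ea Eb modnDm Ec.
  by rewrite !modn_small ?(leq_ltn_trans lc Bp) ?(leq_ltn_trans (leq_add la lb) BBp).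
- move=> [/He[Ea la] [/He[Eb lb] [/He[Ec lc] _]]] H; apply/eqP.
  have := modn_dvdm (fuse u K t a * fuse u K t b) pM; rewrite H modn_dvdm //.
  rewrite -modnMm Ea Eb modnMm Ec.
  by rewrite !modn_small ?(leq_ltn_trans lc Bp) ?(leq_ltn_trans (leq_mul la lb) B2p).
Qed.

Lemma ball_complete (S : seq (atom var)) (u : V -> nat) y :
  (forall k, k < y -> exists x, all (holds (case_sum (at_index u k) x)) S) ->
  exists t B K, [/\ y <= B, ball_prod B y %| K + (beta_base (ball_base B)).+1
    & All (ball_atom B K y u t) S].
Proof.
move=> H.
have [x Hx] : exists x : nat -> X -> nat,
   forall k, k < y -> all (holds (case_sum (at_index u k) (x k))) S.
  suff /boolp.choice[x Hx] : forall k, exists x : X -> nat,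
    k < y -> all (holds (case_sum (at_index u k) x)) S by exists x.
  by move=> k; have [/H[x Hx]|] := boolP (k < y); [exists x|exists (fun _ => 0)].
pose e k := case_sum (at_index u k) (x k).
(* Summing over [k <= y] keeps the range nonempty for [y = 0], so that [B] bounds the parameters in
   that case too. *)
pose h a := \sum_(k < y.+1) e k a.
pose B := y + \sum_(A <- S) \sum_(a <- atom_vars A) h a.
have yB : y <= B by apply: leq_addr.
have yz : y <= ball_base B by rewrite /ball_base; lia.
have [t Ht] : exists t : X -> nat, forall a k, k < y ->
   t a = x k a %[mod beta_mod (beta_base (ball_base B)) k].
  suff /boolp.choice[t Ht] : forall a, exists t, forall k, k < y ->
    t = x k a %[mod beta_mod (beta_base (ball_base B)) k] by exists t.
  by move=> a; apply: (beta_exists (fun k => x k a)).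
have [K HK] := beta_exists id yz.
exists t, B, K; split=> //.
  apply: dvdn_bin_beta => // k ky.
  have kz := leq_trans ky yz.
  rewrite /dvdn -modnDml HK // modnDml addnS addnC -addnS.
  exact: dvdn_beta_mod.
have bound : All (fun A => All (fun a => forall k, k <= y -> e k a <= B) (atom_vars A)) S.
  apply: All_impl (All_leq_sum (fun A => \sum_(a <- atom_vars A) h a) S) => A leA.
  apply: All_impl (All_leq_sum h (atom_vars A)) => a lea k ky.
  apply: (@leq_trans (h a)); first by rewrite /h (bigD1 (Ordinal (ky : k < y.+1))) //= leq_addr.
  by apply: (leq_trans lea); apply: leq_trans leA _; apply: leq_addl.
have Hold : All (fun A => forall k, k < y -> holds (e k) A) S.
  apply: All_forall => k; have [ky|] := boolP (k < y).
    by have /AllE := Hx k ky; apply: All_impl.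
  by move=> _; elim: (S).
have Ef a k : k < y ->
   fuse u K t a = e k a %[mod beta_mod (beta_base (ball_base B)) k].
  by case: a => [[b|]|a] ky //=; [apply: HK|apply: Ht].
have Eb a : (forall k, k <= y -> e k a <= B) -> fuse_bound B (ball_prod B y) u t a.
  case: a => [[b|]|a] //= le; last first.
    apply: dvdn_bin_beta => // k ky.
    apply: beta_mod_dvd_binomial (Ht a k ky); first exact: leq_trans yz.
      by rewrite ltnS; apply/le/ltnW.
    by rewrite /ball_base; lia.
  exact: (le 0).
apply: All_impl (All_and bound Hold) => A [bA hA]; split.
  by apply: All_impl bA.
case: A {bA} hA => [a|a b c|a b c] hA; apply: eq_mod_bin_beta => // k ky.
- by rewrite (Ef a k ky); move: (hA k ky) => /eqP/= ->.
- by rewrite -modnDm !(Ef _ k ky) modnDm; move: (hA k ky) => /eqP/= ->.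
- by rewrite -modnMm !(Ef _ k ky) modnMm; move: (hA k ky) => /eqP/= ->.
Qed.

Lemma dio_ball_var (R : nat -> (V -> nat) -> Prop) (S : seq (atom var)) :
  (forall v : option V -> nat, R (v None) (fun a => v (Some a)) <->
     exists x, all (holds (case_sum v x)) S) ->
  dio (fun v : option V -> nat => forall k, k < v None -> R k (fun a => v (Some a))).
Proof.
move=> HR.
apply: (@dio_ext _ (fun v : option V -> nat => exists t B K,
    v None <= B /\ ball_prod B (v None) %| K + (beta_base (ball_base B)).+1 /\
    All (ball_atom B K (v None) (fun a => v (Some a)) t) S)).
  move=> v; split=> [H|[t [B [K [yB [MK HS]]]]] k ky].
    have [|t [B [K [? ? ?]]]] := @ball_complete S (fun a => v (Some a)) (v None).
      by move=> k /H; rewrite -(HR (at_index _ k)).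
    by exists t, B, K.
  have := ball_sound yB MK HS ky; by rewrite -(HR (at_index _ k)).
apply: dio_exfun.
rewrite /ball_atom /ball_prod /beta_base /ball_base.
do 2!dio_step; apply: dio_and; first by repeat dio_step.
apply: dio_and; first by repeat dio_step.
set B := Some None; set K := None.
have DM W (f g : (W -> nat) -> nat) : dfun f -> dfun g -> dfun (fun v => ball_prod (f v) (g v)).
  by rewrite /ball_prod /beta_base /ball_base => Hf Hg; repeat dio_step.
apply: dio_All => A; apply: dio_and.
  apply: dio_All => -[[b|]|a] /=; [by repeat dio_step|exact: dio_true|].
  by apply: dio_dvd; [apply: DM|]; repeat dio_step.
have Df a : dfun (fun v : option (option (option V + X)) -> nat =>
   fuse (fun b => v (Some (Some (inl (Some b))))) (v None)
        (fun x => v (Some (Some (inr x)))) a).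
  by case: a => [[b|]|a] /=; apply: dfun_var.
case: A => [a|a b c|a b c] /=.
- by apply: dio_modeq; [apply: Df|apply: dfun_const|apply: DM; repeat dio_step].
- by apply: dio_modeq; [apply: dfun_add; apply: Df|apply: Df|apply: DM; repeat dio_step].
- by apply: dio_modeq; [apply: dfun_mul; apply: Df|apply: Df|apply: DM; repeat dio_step].
Qed.

End BoundedForall.

Lemma dio_ball V (R : nat -> (V -> nat) -> Prop) (f : (V -> nat) -> nat) :
  dio (fun v : option V -> nat => R (v None) (fun a => v (Some a))) -> dfun f ->
  dio (fun v => forall k, k < f v -> R k v).
Proof.
move=> [X [S HS]] Hf.
apply: (@dio_ext _ (fun v => exists y, y = f v /\ forall k, k < y -> R k v)).
  by move=> v; split=> [H|[y [-> H]]] //; exists (f v).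
apply: dio_ex; apply: dio_and; first exact: Hf.
exact: (dio_ball_var HS).
Qed.

(** * Graphs of recursive functions are Diophantine *)

Definition beta (x z k : nat) : nat := x %% beta_mod (beta_base z) k.

Lemma beta_surj y (s : nat -> nat) : exists x z, forall k, k <= y -> beta x z k = s k.
Proof.
(* Each modulus exceeds [z! >= z], hence exceeds every term, so residues return the terms
   themselves. *)
pose z := (y + \sum_(k < y.+1) s k).+1.
have yz : y.+1 <= z by rewrite ltnS leq_addr.
have [x Hx] := beta_exists s yz; exists x, z => k ky.
rewrite /beta Hx ?ltnS // modn_small // /beta_mod ltnS.
have kz : k < z by apply: leq_ltn_trans yz.
have sz : s k <= z.
  apply: leqW; rewrite (bigD1 (Ordinal (ky : k < y.+1))) //=; lia.
apply: leq_trans sz _.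
have zf : z <= z`! by apply: dvdn_leq; [apply: fact_gt0|apply: dvdn_fact; rewrite leqnn].
apply: (leq_trans zf); rewrite /beta_base -muln_divA ?dvdn_fact //.
by rewrite leq_pmulr // divn_gt0 //; apply: leq_trans zf.
Qed.

Lemma dfun_divS V (f g : (V -> nat) -> nat) :
  dfun f -> dfun g -> dfun (fun v => f v %/ (g v).+1).
Proof.
apply: (@dfun_comp2 _ (fun m d => m %/ d.+1)).
apply: (@dio_ext _ (fun v => v (Some true) * (v None).+1 <= v (Some false) /\
   v (Some false) < (v (Some true)).+1 * (v None).+1)).
  by move=> v; apply: eq_divn.
by repeat dio_step.
Qed.

Lemma dfun_modS V (f g : (V -> nat) -> nat) :
  dfun f -> dfun g -> dfun (fun v => f v %% (g v).+1).
Proof.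
apply: (@dfun_comp2 _ (fun m d => m %% d.+1)).
apply: (@dio_ext _ (fun v => v (Some true) < (v None).+1 /\
   v (Some true) = v (Some false) %[mod (v None).+1])).
  move=> v; split=> [->|[lt <-]]; first by rewrite ltn_mod modn_mod.
  by rewrite modn_small.
by repeat dio_step.
Qed.

Lemma dfun_beta V (f g h : (V -> nat) -> nat) :
  dfun f -> dfun g -> dfun h -> dfun (fun v => beta (f v) (g v) (h v)).
Proof.
move=> Hf Hg Hh; rewrite /beta /beta_mod.
apply: dfun_modS => //; apply: dfun_divS => //.
by rewrite /beta_base; repeat dio_step.
Qed.

Definition fcons A n (x : A) (f : 'I_n -> A) (j : 'I_n.+1) : A :=
  if unlift ord0 j is Some i then f i else x.

Lemma mktuple_fcons A n (x : A) (f : 'I_n -> A) :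
  [tuple fcons x f j | j < n.+1] = [tuple of x :: [tuple f i | i < n]].
Proof.
apply: eq_from_tnth => j; rewrite tnth_mktuple /fcons.
by case: unliftP => [i ->|->]; rewrite ?tnthS ?tnth_mktuple ?tnth0.
Qed.

Lemma behead_mktuple A n (f : 'I_n.+1 -> A) :
  [tuple of behead [tuple f i | i < n.+1]] = [tuple f (lift ord0 i) | i < n].
Proof.
apply: eq_from_tnth => i; rewrite tnth_behead !tnth_mktuple; congr f.
by apply: val_inj; rewrite /= inordK // ltnS.
Qed.

Lemma dfun_fcons V n x (f : 'I_n -> (V -> nat) -> nat) :
  dfun x -> (forall i, dfun (f i)) ->
  forall j, dfun (fun v => fcons (x v) (fun i => f i v) j).
Proof. by move=> Hx Hf j; rewrite /fcons; case: unliftP. Qed.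

(* [fingraph] exports another [rgraph]. *)
Local Notation rgraph := Defs.rgraph.

(** The arguments and the value are arbitrary Diophantine functions over an arbitrary [V], because
    the induction hypotheses are used in contexts enlarged by bound variables. *)
Lemma dio_rgraph n (e : recfun n) V (f : 'I_n -> (V -> nat) -> nat) g :
  (forall i, dfun (f i)) -> dfun g ->
  dio (fun v => rgraph e [tuple f i v | i < n] (g v)).
Proof.
elim: e V f g => {n} [n|| n i|k n e IHe h IHh|n e IHe h IHh|n e IHe] V f g Hf Hg /=.
- by apply: dio_eq => //; apply: dfun_const.
- apply: (@dio_ext _ (fun v => g v = (f ord0 v).+1)).
    by move=> v; rewrite /thead tnth_mktuple.
  by apply: dio_eq => //; apply: dfun_succ.
- apply: (@dio_ext _ (fun v => g v = f i v)); last exact: dio_eq.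
  by move=> v; rewrite tnth_mktuple.
- apply: (@dio_ext _ (fun v => exists w : 'I_k -> nat,
    (forall i, rgraph (h i) [tuple f i v | i < n] (w i))
    /\ rgraph e [tuple w i | i < k] (g v))).
    move=> v; split=> [[w H1 H2]|[w [H1 H2]]].
      exists (tnth w); split=> //.
      suff -> : [tuple tnth w i | i < k] = w by [].
      by apply: eq_from_tnth => i; rewrite tnth_mktuple.
    by exists [tuple w i | i < k] => // i; rewrite tnth_mktuple.
  apply/dio_exfun/dio_and.
    apply: dio_all => i; apply: (IHh i _ (fun j v => f j (fun a => v (inl a)))).
      by move=> j; apply: (dfun_rename inl (Hf j)).
    exact: dfun_var.
  apply: (IHe _ (fun i v => v (inr i))); last exact: (dfun_rename inl Hg).
  by move=> i; apply: dfun_var.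
- pose b v i := f (lift ord0 i) v.
  apply: (@dio_ext _ (fun v => exists x z,
    rgraph e [tuple b v i | i < n] (beta x z 0) /\
    (forall i, i < f ord0 v ->
       rgraph h [tuple fcons i (fcons (beta x z i) (b v)) j | j < n.+2]
         (beta x z i.+1)) /\
    g v = beta x z (f ord0 v))).
    move=> v; have Eb := congr1 val (behead_mktuple (fun i => f i v)).
    rewrite behead_mktuple {1 2}/thead tnth_mktuple.
    split=> [[s [H0 HS Hg']]|[x [z [H0 [HS Hg']]]]].
      have [x [z E]] := beta_surj (f ord0 v) s.
      exists x, z; rewrite !E //; split=> //; split=> // i lt.
      have := HS i lt; rewrite !E ?(ltnW lt) // !mktuple_fcons.
      by congr rgraph; apply: val_inj; congr [:: _, _ & _].
    exists (beta x z); split=> // i lt.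
    have := HS i lt; rewrite !mktuple_fcons.
    by congr rgraph; apply: val_inj; congr [:: _, _ & _].
  have Hb i : dfun (fun v => b v i) by apply: Hf.
  apply/dio_ex/dio_ex/dio_and; last apply: dio_and.
  + apply: (IHe _ (fun i v => b (fun a => v (Some (Some a))) i)).
      by move=> i; apply: (dfun_rename (fun a => Some (Some a)) (Hb i)).
    by apply: dfun_beta; [apply: dfun_var|apply: dfun_var|apply: dfun_const].
  + apply: (@dio_ball _ (fun i v => rgraph h [tuple fcons i (fcons
      (beta (v (Some None)) (v None) i) (b (fun a => v (Some (Some a))))) j
      | j < n.+2] (beta (v (Some None)) (v None) i.+1))).
      apply: (IHh _ (fun j v => fcons (v None) (fcons (beta (v (Some (Some None)))
        (v (Some None)) (v None)) (b (fun a => v (Some (Some (Some a)))))) j)).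
        apply: (dfun_fcons (f := fun j v => fcons (beta (v (Some (Some None)))
        (v (Some None)) (v None)) (b (fun a => v (Some (Some (Some a))))) j)).
          exact: dfun_var.
        apply: (dfun_fcons (f := fun j v => b (fun a => v (Some (Some (Some a)))) j)).
          by apply: dfun_beta; apply: dfun_var.
        by move=> i; apply: (dfun_rename (fun a => Some (Some (Some a))) (Hb i)).
      apply: dfun_beta; [apply: dfun_var|apply: dfun_var|].
      by apply: dfun_succ; apply: dfun_var.
    exact: (dfun_rename (fun a => Some (Some a)) (Hf ord0)).
  + apply: dio_eq; first exact: (dfun_rename (fun a => Some (Some a)) Hg).
    apply: dfun_beta; [apply: dfun_var|apply: dfun_var|].
    exact: (dfun_rename (fun a => Some (Some a)) (Hf ord0)).
- apply: (@dio_ext _ (fun v =>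
    rgraph e [tuple fcons (g v) (fun i => f i v) j | j < n.+1] 0 /\
    forall i, i < g v -> exists z,
      rgraph e [tuple fcons i (fun i => f i v) j | j < n.+1] z.+1)).
    move=> v; rewrite mktuple_fcons.
    split=> -[H0 H]; split=> // i /H[z Hz]; exists z; move: Hz;
      by rewrite mktuple_fcons.
  apply: dio_and.
    apply: (IHe _ (fun j v => fcons (g v) (fun i => f i v) j)).
      exact: dfun_fcons.
    exact: dfun_const.
  apply: (@dio_ball _ (fun i v => exists z,
      rgraph e [tuple fcons i (fun i => f i v) j | j < n.+1] z.+1)) => //.
  apply: dio_ex.
  apply: (IHe _ (fun j v => fcons (v (Some None))
     (fun i => f i (fun a => v (Some (Some a)))) j)).
    apply: (dfun_fcons (f := fun i v => f i (fun a => v (Some (Some a))))).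
      exact: dfun_var.
    by move=> i; apply: (dfun_rename (fun a => Some (Some a)) (Hf i)).
  by apply: dfun_succ; apply: dfun_var.
Qed.

(** * Coding by prime exponents *)

Fixpoint prime_code (ps ts : seq nat) : nat :=
  match ps, ts with
  | p :: ps', t :: ts' => p ^ t * prime_code ps' ts'
  | _, _ => 1
  end.

Lemma prime_code_gt0 ps ts : all prime ps -> 0 < prime_code ps ts.
Proof.
elim: ps ts => [|p ps IH] [|t ts] //= /andP[pp /IH H].
by rewrite muln_gt0 expn_gt0 prime_gt0 //= H.
Qed.

Lemma logn_prime_code q ps ts : uniq ps -> all prime ps -> size ps = size ts ->
  logn q (prime_code ps ts) = nth 0 ts (index q ps).
Proof.
elim: ps ts => [|p ps IH] [|t ts] //=; first by rewrite logn1.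
move=> /andP[pn up] /andP[pp ap] [Es].
rewrite lognM ?prime_code_gt0 ?expn_gt0 ?prime_gt0 // lognX logn_prime // IH //.
rewrite eq_sym; case: eqVneq => [<-|_] /=; last by rewrite muln0.
rewrite muln1 nth_default ?addn0 //.
by rewrite memNindex // Es.
Qed.

Lemma exponentsE m : exponents m = [seq logn p m | p <- primes m].
Proof. by rewrite /exponents prime_decompE -map_comp. Qed.

Lemma exponents_prime_code ps ts : sorted ltn ps -> all prime ps ->
  size ps = size ts -> all (leq 1) ts -> exponents (prime_code ps ts) = ts.
Proof.
move=> sp ap Es t0; have up := sorted_uniq ltn_trans ltnn sp.
have -> : exponents (prime_code ps ts) = [seq logn p (prime_code ps ts) | p <- ps].
  rewrite exponentsE; congr map.
  apply: (irr_sorted_eq ltn_trans ltnn (sorted_primes _) sp) => p.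
  rewrite -logn_gt0 logn_prime_code //.
  case: (boolP (p \in ps)) => [pps|/memNindex ->]; last by rewrite Es nth_default.
  by apply: (allP t0); apply: mem_nth; rewrite -Es index_mem.
apply: (@eq_from_nth _ 0); rewrite size_map // => i lti.
by rewrite (nth_map 0) // logn_prime_code // index_uniq.
Qed.

Lemma prod_primes_gt0 ps : all prime ps -> 0 < \prod_(p <- ps) p.
Proof.
elim: ps => [|p ps IH] /=; first by rewrite big_nil.
by move=> /andP[pp /IH H]; rewrite big_cons muln_gt0 prime_gt0.
Qed.

Lemma prime_code_leq D ps ts : all prime ps -> all (geq D) ts ->
  prime_code ps ts <= (\prod_(p <- ps) p) ^ D.
Proof.
elim: ps ts => [|p ps IH] [|t ts] //=; rewrite ?big_nil ?exp1n //.
  by move=> ap _; rewrite expn_gt0 prod_primes_gt0.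
move=> /andP[pp ap] /andP[tD aD]; rewrite big_cons expnMn leq_mul ?IH //.
by rewrite leq_pexp2l // prime_gt0.
Qed.

Definition primes_upto (b : nat) : seq nat := [seq p <- iota 0 b.+1 | prime p].

Lemma sorted_primes_upto b : sorted ltn (primes_upto b).
Proof. by apply: sorted_filter; [apply: ltn_trans|apply: iota_ltn_sorted]. Qed.

Lemma all_prime_primes_upto b : all prime (primes_upto b).
Proof. by apply/allP => p; rewrite mem_filter => /andP[]. Qed.

Lemma mem_primes_upto b p : (p \in primes_upto b) = prime p && (p <= b).
Proof. by rewrite mem_filter mem_iota ltnS. Qed.

(** Euclid's argument: a prime factor of the product plus 1 lies above [b]. *)
Lemma primes_upto_next b : 1 < b -> exists q,
  primes_upto q = rcons (primes_upto b) q /\ b < q <= (\prod_(p <- primes_upto b) p).+1.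
Proof.
move=> b1; set M := \prod_(p <- _) p.
pose r := pdiv M.+1.
have M0 : 0 < M by apply/prod_primes_gt0/all_prime_primes_upto.
have rp : prime r by apply: pdiv_prime.
have br : b < r.
  rewrite ltnNge; apply/negP => rb.
  have rM : r %| M.
    rewrite /M (big_rem r) ?mem_primes_upto ?rp //=; exact: dvdn_mulr.
  have := pdiv_dvd M.+1; rewrite -/r -addn1 dvdn_addr // dvdn1 => /eqP r1.
  by rewrite r1 in rp.
have ex : exists q, prime q && (b < q) by exists r; rewrite rp.
case: (ex_minnP ex) => q /andP[qp bq] qmin; exists q; split; last first.
  rewrite bq /=; apply: (@leq_trans r); first by apply: qmin; rewrite rp.
  by apply: dvdn_leq => //; apply: pdiv_dvd.
rewrite {1}/primes_upto (_ : q.+1 = b.+1 + (q - b.+1) + 1); last by lia.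
rewrite !iotaD !filter_cat -cats1; congr (_ ++ _).
  rewrite [X in _ ++ X](@eq_in_filter _ _ pred0) ?filter_pred0 ?cats0 // => p.
  rewrite mem_iota => /andP[bp pq]; apply/negP => pp.
  have := qmin p; rewrite pp bp => /(_ isT); move: pq; clear - bq; lia.
by rewrite subnKC //= add0n qp.
Qed.

(** If [M] is the product so far, Euclid bounds the next prime by [M + 1 <= 2 M]; with the factor 2
    kept in the statement, the bound is just squared at each step. *)
Lemma primes_upto_exists d : exists b, [/\ 7 <= b, size (primes_upto b) = d + 4
  & 2 * \prod_(p <- primes_upto b) p <= 2 ^ 2 ^ (d + 4)].
Proof.
elim: d => [|d [b [b7 sb Hb]]].
  exists 7; split=> //; rewrite /primes_upto /= !big_cons big_nil.
  (* The primes 2, 3, 5, 7 give 420, below [2 ^ 9] and so below [2 ^ 2 ^ 4]. *)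
  by apply: (@leq_trans (2 ^ 9)) => //; rewrite leq_exp2l.
have [|q [Eq /andP[bq qM]]] := @primes_upto_next b; first exact: leq_trans b7.
exists q; split; first exact: leq_trans (ltnW bq).
  by rewrite Eq size_rcons sb.
have -> : 2 ^ 2 ^ (d.+1 + 4) = 2 ^ 2 ^ (d + 4) * 2 ^ 2 ^ (d + 4).
  by rewrite addSn expnS mul2n -addnn expnD.
rewrite Eq -cats1 big_cat big_seq1 /= mulnA.
apply: leq_mul => //; apply: leq_trans Hb; apply: leq_trans qM _.
have := prod_primes_gt0 (all_prime_primes_upto b); lia.
Qed.

Lemma primes_upto_prefix b : 7 <= b -> exists s, primes_upto b = [:: 2, 3, 5, 7 & s].
Proof.
move=> b7; exists [seq p <- iota 8 (b - 7) | prime p].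
rewrite /primes_upto; have -> : b.+1 = 8 + (b - 7) by lia.
by rewrite iotaD filter_cat.
Qed.

(** Four positive exponents on 2, 3, 5, 7 make the number a multiple of 210, hence of the form that
    the procedure factors. *)
Lemma exponents_surj ts D : 4 <= size ts -> all (leq 1) ts -> all (geq D) ts ->
  exists n, exponents (210 * n.+1) = ts /\ n < 2 ^ (D * 2 ^ size ts).
Proof.
move=> s4 t1 tD.
have [b [b7 sb Mb]] := primes_upto_exists (size ts - 4).
rewrite subnK // in sb Mb.
have [s Es] := primes_upto_prefix b7.
have ap := all_prime_primes_upto b.
set ps := primes_upto b in sb Mb Es ap.
have Ex := exponents_prime_code (sorted_primes_upto b) ap sb t1.
have N0 := prime_code_gt0 ts ap.
have NB := prime_code_leq ap tD.
have dv : 210 %| prime_code ps ts.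
  rewrite Es; case: (ts) s4 t1 => [|x [|y [|z [|t r]]]] //= _.
  move=> /and5P[x0 y0 z0 t0 _]; rewrite (_ : 210 = 2 * (3 * (5 * (7 * 1)))) //.
  by repeat apply: dvdn_mul => //; rewrite -[X in X %| _]expn1 dvdn_exp2l.
have /dvdnP[[|n] En] := dv; first by rewrite En in N0.
exists n; rewrite mulnC -En; split=> //.
apply: (@leq_trans (prime_code ps ts)); first by rewrite En; lia.
apply: leq_trans NB _; rewrite mulnC expnM.
case: D {tD} => [//|D]; rewrite leq_exp2r //.
by apply: leq_trans Mb; rewrite leq_pmull.
Qed.

(** Exponents are positive, so idle places are padded with 1; the tag 3 represents all values above
    2. *)
Definition equation_exponents (E : equation) : seq nat :=
  match E with
  | EqOne a => [:: a; 1; 1; 1]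
  | EqAdd a b c => [:: a; b; c; 2]
  | EqMul a b c => [:: a; b; c; 3]
  end.

Definition equation_vars (E : equation) : seq nat :=
  match E with
  | EqOne a => [:: a]
  | EqAdd a b c => [:: a; b; c]
  | EqMul a b c => [:: a; b; c]
  end.

Lemma nth_flatten4 T (f : T -> seq nat) s x0 i r : (forall x, size (f x) = 4) ->
  i < size s -> r < 4 -> nth 0 (flatten (map f s)) (4 * i + r) = nth 0 (f (nth x0 s i)) r.
Proof.
move=> f4 + r4; elim: s i => [//|x s IH] [|i] /= lti.
  by rewrite muln0 add0n nth_cat f4 r4.
by rewrite nth_cat f4 mulnS -addnA ltnNge leq_addr /= addKn IH.
Qed.

Lemma system_surj (Es : seq equation) D : 0 < size Es -> 3 <= D ->
  All (fun E => all (fun a => 0 < a <= D) (equation_vars E)) Es ->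
  exists n, system n = Es /\ n < 2 ^ (D * 2 ^ (4 * size Es)).
Proof.
move=> s0 D3 HE; pose ts := flatten (map equation_exponents Es).
have e4 E : size (equation_exponents E) = 4 by case: E.
have sts : size ts = 4 * size Es.
  rewrite /ts; elim: (Es) => [//|E s IH] /=.
  by rewrite size_cat IH e4 mulnS.
have [ts1 tsD] : all (leq 1) ts /\ all (geq D) ts.
  rewrite /ts; elim: (Es) HE => [//|E s IH] /= [HE /IH[H1 H2]].
  rewrite !all_cat H1 H2 !andbT; move: HE; clear - D3.
  case: E => [a|a b c|a b c] /=; rewrite !andbT.
  - by move=> /andP[-> ->] /=; split=> //; apply/and3P; split; lia.
  - move=> /and3P[/andP[-> ->] /andP[-> ->] /andP[-> ->]] /=; split=> //; lia.
  - move=> /and3P[/andP[-> ->] /andP[-> ->] /andP[-> ->]] /=; split=> //; lia.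
have [|n [En Hn]] := @exponents_surj ts D _ ts1 tsD; first by rewrite sts; lia.
exists n; rewrite -sts; split=> //.
apply: (@eq_from_nth _ (EqOne 0)).
  by rewrite /system En size_map size_iota sts mulKn.
move=> i; rewrite /system En size_map size_iota sts mulKn // => lti.
rewrite (nth_map 0) ?size_iota // nth_iota // add1n.
have T r : r < 4 -> nth 0 ts (4 * i + r) = nth 0 (equation_exponents (nth (EqOne 0) Es i)) r.
  by move=> r4; apply: nth_flatten4.
have -> : (4 * i.+1).-1 = 4 * i + 3 by lia.
have -> : (4 * i.+1 - 3).-1 = 4 * i + 0 by lia.
have -> : (4 * i.+1 - 2).-1 = 4 * i + 1 by lia.
have -> : (4 * i.+1 - 1).-1 = 4 * i + 2 by lia.
by rewrite !T //; case: (nth (EqOne 0) Es i).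
Qed.

Lemma witness_surj w : 4 <= size w -> exists m, 1 < m /\ witness m = w.
Proof.
move=> w4; pose ts := map succn w.
have [|||n [En _]] := @exponents_surj ts (\sum_(t <- ts) t).
- by rewrite size_map.
- by apply/allP => t /mapP[x _ ->].
- by apply/allP => t tts; rewrite /= (big_rem t) //= leq_addr.
exists (210 * n.+1); split; first by lia.
by rewrite /witness En -map_comp map_id.
Qed.

(** * Unboundedness *)

Lemma rgraph_inj n (e : recfun n) v y y' : rgraph e v y -> rgraph e v y' -> y = y'.
Proof.
elim: e v y y' => {n} [n|| n i|k n e IHe h IHh|n e IHe h IHh|n e IHe] v y y' /=.
- by move=> -> ->.
- by move=> -> ->.
- by move=> -> ->.
- move=> [w Hw Hy] [w' Hw' Hy']; have E : w = w'.
    by apply: eq_from_tnth => i; apply: IHh (Hw i) (Hw' i).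
  by rewrite E in Hy; apply: IHe Hy Hy'.
- move=> [s [H0 HS ->]] [s' [H0' HS' ->]].
  suff H i : i <= thead v -> s i = s' i by apply: H.
  elim: i => [_|i IH lt]; first exact: IHe H0 H0'.
  have := HS i lt; rewrite (IH (ltnW lt)) => H.
  exact: IHh H (HS' i lt).
- move=> [H0 H] [H0' H']; case: (ltngtP y y') => // lt.
    by have [z Hz] := H' _ lt; have := IHe _ _ _ H0 Hz.
  by have [z Hz] := H _ lt; have := IHe _ _ _ H0' Hz.
Qed.

Definition atom_equation (A : atom nat) : equation :=
  match A with
  | AOne a => EqOne a
  | AAdd a b c => EqAdd a b c
  | AMul a b c => EqMul a b c
  end.

Lemma satisfies_atom w A : satisfies w (atom_equation A) =
  all (fun a => 0 < a <= size w) (atom_vars A) && holds (fun a => nth 0 w a.-1) A.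
Proof. by case: A => [a|a b c|a b c] /=; rewrite ?andbT -?andbA. Qed.

Lemma equation_vars_atom A : equation_vars (atom_equation A) = atom_vars A.
Proof. by case: A. Qed.

Lemma atom_vars_map V W (f : V -> W) A : atom_vars (map_atom f A) = map f (atom_vars A).
Proof. by case: A. Qed.

Lemma eq_holds_in V (v w : V -> nat) A : All (fun a => v a = w a) (atom_vars A) ->
  holds v A = holds w A.
Proof.
by case: A => [a [/= ->]|a b c [/= -> [-> [-> _]]]|a b c [/= -> [-> [-> _]]]].
Qed.

(* Any solution has [v a.+2 = 2 ^ 2 ^ a]: this lets a short system of
   equations speak about its own code. *)
Definition squaring_chain (a : nat) : seq (atom nat) :=
  [:: AOne 1, AAdd 1 1 2 & [seq AMul j.+2 j.+2 j.+3 | j <- iota 0 a]].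

Lemma squaring_chainP a v : all (holds v) (squaring_chain a) ->
  forall j, j <= a -> v j.+2 = 2 ^ 2 ^ j.
Proof.
move=> /= /and3P[/eqP v1 /eqP v2 H]; elim=> [_|j IH lt]; first by rewrite -v2 v1.
have jin : j \in iota 0 a by rewrite mem_iota.
move: H; rewrite all_map => /allP/(_ j jin)/eqP <-.
by rewrite IH 1?ltnW // expnS mul2n -addnn expnD.
Qed.

(** Positions in the list give the numbers, equality being decided classically. The entry at the
    head gets 0, which later makes one variable coincide with the end of the squaring chain. *)
Lemma numbering T (s : seq T) : exists num : T -> nat,
  (forall a, num a <= size s) /\
  (forall a s', s = a :: s' -> num a = 0) /\
  All (fun a => num a < size s) s /\
  forall v : T -> nat, exists w, All (fun a => w (num a) = v a) s.
Proof.
pose num (a : T) := index (a : {classic T}) (s : seq {classic T}).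
have All_in (P : T -> Prop) :
    (forall a, (a : {classic T}) \in (s : seq {classic T}) -> P a) -> All P s.
  rewrite /num; elim: (s) => [//|a s' IH] H /=; split.
    by apply: H; rewrite inE eqxx.
  by apply: IH => b bs; apply: H; rewrite inE bs orbT.
exists num; split; [|split; [|split]].
- by move=> a; apply: index_size.
- by move=> a s' E; rewrite /num E /= eqxx.
- by apply: All_in => a as_; rewrite /num index_mem.
- move=> v; exists (fun j => nth 0 (map v s) j); apply: All_in => a as_.
  by rewrite (nth_map a) ?index_mem // /num nth_index.
Qed.

Lemma exists_linear_lt_exp c : exists a, 5 * a + c <= 2 ^ a.
Proof.
exists (c + 10); elim: c => [//|c IH].
rewrite addSn expnS; lia.
Qed.

Lemma All_cat T (P : T -> Prop) s t : All P (s ++ t) -> All P s /\ All P t.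
Proof. by elim: s => [//|a s IH] /= [Pa /IH[]]. Qed.

Lemma All_flatten T U (P : U -> Prop) (f : T -> seq U) s :
  All P (flatten (map f s)) -> All (fun A => All P (f A)) s.
Proof. by elim: s => [//|A s IH] /= /All_cat[PA /IH]. Qed.

Lemma xi_unbounded (Gamma : nat -> nat) : computable Gamma ->
  exists n, Gamma n < xi n.
Proof.
move=> [e He].
pose R (v : bool -> nat) := forall i, i < 2 ^ v true ->
  exists z, rgraph e [tuple i] z /\ z < v false.
have dR : dio R.
  have E1 (v : option bool -> nat) : [tuple v None] = [tuple (fun _ v => v None) i v | i < 1].
    by apply: eq_from_tnth => i; rewrite tnth_mktuple (tnth_nth 0) ord1.
  apply: (@dio_ball _ (fun i v => exists z, rgraph e [tuple i] z /\ z < v false)).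
    apply/dio_ex/dio_and; last by repeat dio_step.
    apply: (@dio_ext _ (fun v => rgraph e [tuple (fun _ v => v (Some None)) i v | i < 1]
             (v None))).
      move=> v; suff -> : [tuple v (Some None)] = [tuple v (Some None) | i < 1] by [].
      by apply: eq_from_tnth => i; rewrite tnth_mktuple (tnth_nth 0) ord1.
    apply: (dio_rgraph e (f := fun _ v => v (Some None))) => [i|]; exact: dfun_var.
  by repeat dio_step.
have [X [S HS]] := dR.
(* [inl true] is [V], placed first so as to be numbered 0; [inl false] is [y], listed in case no
   atom of [S] mentions it. *)
pose L : seq (bool + X) := inl true :: inl false :: flatten (map (@atom_vars _) S).
have [num [num_le [num0 [num_lt num_val]]]] := numbering L.
have {}num0 : num (inl true) = 0 by apply: num0.
(* The code is below [2 ^ 2 ^ (D + 4 N)], with [D = a + 2 + size L] variables and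
   [N = a + 2 + size S] equations; the inner exponent is [5 a] plus this constant. *)
have [a Ha] := exists_linear_lt_exp (size L + 4 * size S + 10).
(* The shift puts [V] at [a.+2], the last variable of the chain, so no equation is spent on
   identifying them. *)
pose pos (x : bool + X) := a.+2 + num x.
pose D := a.+2 + size L.
pose As := squaring_chain a ++ map (map_atom pos) S.
have D4 : 4 <= D by rewrite /D /=; lia.
have Dvars : all (fun A => all (fun a => 0 < a <= D) (atom_vars A)) As.
  rewrite all_cat; apply/andP; split; last first.
    rewrite all_map; apply: sub_all (all_predT _) => A _ /=; rewrite atom_vars_map all_map.
    apply: sub_all (all_predT _) => x _ /=.
    by rewrite /pos /D leq_add2l num_le.
  apply/AllE; split; first by rewrite /= /D /=; lia.
  split; first by rewrite /= /D /=; lia.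
  by apply/AllE; rewrite all_map; apply/allP => j; rewrite mem_iota /= /D => lt; lia.
have [|||n [En Hn]] := @system_surj (map atom_equation As) D.
- by [].
- exact: leq_trans D4.
- apply/AllE; rewrite all_map; apply: sub_all Dvars => A /=.
  by rewrite equation_vars_atom.
have nlt : n < 2 ^ 2 ^ 2 ^ a.
  apply: leq_trans Hn _; rewrite leq_exp2l //.
  apply: (@leq_trans (2 ^ D * 2 ^ (4 * size (map atom_equation As)))).
    by rewrite leq_mul2r ltnW ?orbT // ltn_expl.
  rewrite -expnD leq_exp2l //; apply: leq_trans Ha.
  have sC : size (squaring_chain a) = a.+2 by rewrite /= size_map size_iota.
  rewrite size_map size_cat sC size_map /D.
  by move: (size L) (size S) => l s; clear; lia.
have sat w : all (satisfies w) (system n) ->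
  all (holds (fun a => nth 0 w a.-1)) As.
  rewrite En all_map; apply: sub_all => A /=.
  by rewrite satisfies_atom => /andP[].
have ex : exists m, accepts n m.
  (* A sum plus 1 exceeds each of its terms, so [y] is above every [Gamma i] required. *)
  pose V := 2 ^ 2 ^ a; pose y := (\sum_(i < 2 ^ V) Gamma i).+1.
  have /HS[x Hx] : R (fun b => if b then V else y).
    move=> i lt; exists (Gamma i); split; first exact: He.
    by rewrite ltnS (bigD1 (Ordinal lt)) //= leq_addr.
  have [w0 Hw0] := num_val (case_sum (fun b => if b then V else y) x).
  (* The place [a.+2] is shared by the chain and the system: there [w0 0 = V = 2 ^ 2 ^ a] meets both
     requirements. *)
  pose wf j := if j < a.+2 then (if j == 1 then 1 else 2 ^ 2 ^ (j - 2))
               else w0 (j - a.+2).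
  have wfpos z : wf (pos z) = w0 (num z).
    by rewrite /wf /pos ltnNge leq_addr /= addKn.
  have wfchain j : j <= a -> wf j.+2 = 2 ^ 2 ^ j.
    rewrite /wf ltnS leq_eqVlt => /orP[/eqP->|lt].
      by rewrite ltnn subnn; case: Hw0; rewrite num0 => ->.
    by rewrite ltnS lt subn2.
  have [m [m1 Em]] := @witness_surj (mkseq (fun j => wf j.+1) D) (leq_trans D4 (eq_leq (esym (size_mkseq _ _)))).
  exists m; rewrite /accepts m1 /= Em En all_map.
  have Hh : all (holds wf) As.
    rewrite all_cat; apply/andP; split.
      apply/AllE; split; first by [].
      split; first by rewrite /= (wfchain 0).
      apply/AllE; rewrite all_map; apply/allP => j; rewrite mem_iota => /andP[_ lt] /=.
      by rewrite !wfchain ?(ltnW lt) // expnS mul2n -addnn expnD.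
    rewrite all_map; move: Hx => /AllE Hx; apply/AllE.
    have [_ [_ /All_flatten Hf]] := Hw0.
    apply: All_impl (All_and Hx Hf) => A [h1 h2] /=.
    rewrite holds_map (eq_holds_in (w := case_sum (fun b => if b then V else y) x)) //.
    by apply: All_impl h2 => z <- /=; apply: wfpos.
  have := conj Dvars Hh => /andP; rewrite -all_predI; apply: sub_all => A /= /andP[h1 h2].
  rewrite satisfies_atom size_mkseq h1 /=.
  move: h2; rewrite -(eq_holds_in (v := fun a => nth 0 (mkseq (fun j => wf j.+1) D) a.-1)) //.
  move/AllE: h1; apply: All_impl => j /andP[j0 jD].
  by rewrite nth_mkseq prednK.
rewrite /xi; exists n; case: pselect => // ex'.
case: ex_minnP => m /andP[_ /sat H] _.
set v := (fun _ => _) in H.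
move: H; rewrite all_cat => /andP[/squaring_chainP/(_ a (leqnn a)) va].
rewrite (@all_holds_map _ _ _ _ (case_sum (fun b => v (pos (inl b))) (fun x => v (pos (inr x)))));
  last by move=> [b|x].
move=> Hall; have : R (fun b => v (pos (inl b))).
  by apply/HS; exists (fun x => v (pos (inr x))).
(* The diagonal moment: the solved system speaks about all [i < 2 ^ V], among them its own code
   [n]. *)
rewrite /R {1}/pos num0 addn0 va => /(_ n nlt)[z [Hz zlt]].
rewrite (rgraph_inj (He n) Hz); apply: (leq_trans zlt).
(* [sat] forgot the range conditions, so the case of an index past the end remains; the default 0 is
   below any maximum. *)
rewrite /answer /v; case: (ltnP (pos (inl false)).-1 (size (witness m))) => [lt|ge].
  by rewrite (big_rem (nth 0 (witness m) (pos (inl false)).-1)) ?mem_nth //= leq_maxl.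
by rewrite nth_default.
Qed.

(** * Computability of the procedure *)

Definition cfun n (f : ('I_n -> nat) -> nat) : Prop :=
  exists e : recfun n, forall v, rgraph e [tuple v i | i < n] (f v).

Lemma cfun_ext n (f g : ('I_n -> nat) -> nat) : f =1 g -> cfun g -> cfun f.
Proof. by move=> E [e He]; exists e => v; rewrite E. Qed.

Lemma cfun_var n (i : 'I_n) : cfun (fun v => v i).
Proof. by exists (RProj i) => v /=; rewrite tnth_mktuple. Qed.

Lemma cfun_comp k n (F : ('I_k -> nat) -> nat) (g : 'I_k -> ('I_n -> nat) -> nat) :
  cfun F -> (forall i, cfun (g i)) -> cfun (fun v => F (fun i => g i v)).
Proof.
move=> [e He] /boolp.choice[h Hh]; exists (RComp e h) => v /=.
by exists [tuple g i v | i < k] => // i; rewrite tnth_mktuple.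
Qed.

Lemma cfun_succ n (f : ('I_n -> nat) -> nat) : cfun f -> cfun (fun v => (f v).+1).
Proof.
move=> Hf; apply: (@cfun_comp 1 n (fun w => (w ord0).+1) (fun _ => f)) => //.
by exists RSucc => v /=; rewrite /thead tnth_mktuple.
Qed.

Lemma cfun_const n c : cfun (fun _ : 'I_n -> nat => c).
Proof. by elim: c => [|c IH]; [exists (RZero n)|apply: cfun_succ]. Qed.

Lemma cfun_rename m n (f : 'I_m -> 'I_n) (F : ('I_m -> nat) -> nat) :
  cfun F -> cfun (fun v => F (fun a => v (f a))).
Proof.
by move=> HF; apply: (cfun_comp (g := fun a v => v (f a))) => // i; apply: cfun_var.
Qed.

Lemma fcons0 A n (x : A) (f : 'I_n -> A) : fcons x f ord0 = x.
Proof. by rewrite /fcons unlift_none. Qed.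

Lemma fconsS A n (x : A) (f : 'I_n -> A) i : fcons x f (lift ord0 i) = f i.
Proof. by rewrite /fcons liftK. Qed.

Lemma cfun_rec n (s : nat -> ('I_n -> nat) -> nat)
    (g : nat -> nat -> ('I_n -> nat) -> nat) (h : ('I_n -> nat) -> nat) :
  cfun (s 0) -> (forall i v, s i.+1 v = g i (s i v) v) ->
  cfun (fun v : 'I_n.+2 -> nat =>
    g (v ord0) (v (lift ord0 ord0)) (fun i => v (lift ord0 (lift ord0 i)))) ->
  cfun h -> cfun (fun v => s (h v) v).
Proof.
move=> [e0 H0] Hs [e1 H1] Hh.
have K : cfun (fun v : 'I_n.+1 -> nat => s (v ord0) (fun i => v (lift ord0 i))).
  exists (RPrim e0 e1) => v /=; exists (fun i => s i (fun i => v (lift ord0 i))).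
  rewrite behead_mktuple {2}/thead tnth_mktuple; split=> // i _; rewrite Hs.
  set r := s i _; set b := fun i => v (lift ord0 i).
  have := H1 (fcons i (fcons r b)).
  rewrite fcons0 fconsS fcons0 !mktuple_fcons.
  have -> : (fun j => fcons i (fcons r b) (lift ord0 (lift ord0 j))) = b.
    by apply/funext => j; rewrite !fconsS.
  have Eb := congr1 val (behead_mktuple v).
  by congr rgraph; apply: val_inj; congr [:: _, _ & _].
have E v : s (h v) v = (fun w : 'I_n.+1 -> nat => s (w ord0) (fun i => w (lift ord0 i)))
    (fun j => fcons (h v) v j).
  by rewrite fcons0; congr (s _ _); apply/funext => i; rewrite fconsS.
apply: (cfun_ext E); apply: (cfun_comp (g := fun j v => fcons (h v) v j) K) => j.
by rewrite /fcons; case: unliftP => [i _|_] //; apply: cfun_var.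
Qed.

Lemma cfun_add n (f g : ('I_n -> nat) -> nat) :
  cfun f -> cfun g -> cfun (fun v => f v + g v).
Proof.
move=> Hf Hg.
apply: (@cfun_rec _ (fun i v => f v + i) (fun _ r _ => r.+1) g) => //.
- by apply: cfun_ext Hf => v; rewrite addn0.
- by move=> i v; rewrite addnS.
- apply: (@cfun_succ _ (fun v => v (lift ord0 ord0))); exact: cfun_var.
Qed.

Lemma cfun_sum n (F : nat -> ('I_n -> nat) -> nat) (b : ('I_n -> nat) -> nat) :
  cfun (fun v : 'I_n.+1 -> nat => F (v ord0) (fun i => v (lift ord0 i))) ->
  cfun b -> cfun (fun v => \sum_(i < b v) F i v).
Proof.
move=> HF Hb.
apply: (@cfun_rec _ (fun k v => \sum_(i < k) F i v) (fun i r v => r + F i v) b) => //.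
- by apply: (@cfun_ext _ _ (fun _ => 0)); [move=> v; rewrite big_ord0|apply: cfun_const].
- by move=> i v; rewrite big_ord_recr.
apply: cfun_add; first exact: cfun_var.
have := cfun_rename (fcons ord0 (fun i => lift ord0 (lift ord0 i))) HF.
apply: cfun_ext => v; rewrite fcons0; congr (F _ _).
by apply/funext => i; rewrite fconsS.
Qed.

Lemma cfun_mul n (f g : ('I_n -> nat) -> nat) :
  cfun f -> cfun g -> cfun (fun v => f v * g v).
Proof.
move=> Hf Hg; apply: (@cfun_ext _ _ (fun v => \sum_(i < f v) g v)).
  by move=> v; rewrite sum_nat_const card_ord.
by apply: (@cfun_sum _ (fun _ => g) f) => //; apply: (cfun_rename (lift ord0) Hg).
Qed.

Lemma cfun_pred n (f : ('I_n -> nat) -> nat) : cfun f -> cfun (fun v => (f v).-1).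
Proof.
move=> Hf; apply: (@cfun_rec _ (fun i _ => i.-1) (fun i _ _ => i) f) => //.
- exact: cfun_const.
- exact: cfun_var.
Qed.

Lemma cfun_sub n (f g : ('I_n -> nat) -> nat) :
  cfun f -> cfun g -> cfun (fun v => f v - g v).
Proof.
move=> Hf Hg.
apply: (@cfun_rec _ (fun i v => f v - i) (fun _ r _ => r.-1) g) => //.
- by apply: cfun_ext Hf => v; rewrite subn0.
- by move=> i v; rewrite subnS.
- apply: (@cfun_pred _ (fun v => v (lift ord0 ord0))); exact: cfun_var.
Qed.

Lemma cfun_expn n (f g : ('I_n -> nat) -> nat) :
  cfun f -> cfun g -> cfun (fun v => f v ^ g v).
Proof.
move=> Hf Hg.
apply: (@cfun_rec _ (fun i v => f v ^ i) (fun _ r v => f v * r) g) => //.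
- exact: cfun_const.
- by move=> i v; rewrite expnS.
apply: cfun_mul; last exact: cfun_var.
exact: (cfun_rename (fun i => lift ord0 (lift ord0 i)) Hf).
Qed.

Lemma cfun_max n (F : nat -> ('I_n -> nat) -> nat) (b : ('I_n -> nat) -> nat) :
  cfun (fun v : 'I_n.+1 -> nat => F (v ord0) (fun i => v (lift ord0 i))) ->
  cfun b -> cfun (fun v => \max_(i < b v) F i v).
Proof.
move=> HF Hb.
apply: (@cfun_rec _ (fun k v => \max_(i < k) F i v)
          (fun i r v => r + (F i v - r)) b) => //.
- by apply: (@cfun_ext _ _ (fun _ => 0)); [move=> v; rewrite big_ord0|apply: cfun_const].
- by move=> i v; rewrite big_ord_recr /= maxnE.
have HF' := cfun_rename (fcons ord0 (fun i => lift ord0 (lift ord0 i))) HF.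
apply: cfun_add; first exact: cfun_var.
apply: cfun_sub; last exact: cfun_var.
apply: cfun_ext HF' => v; rewrite fcons0; congr (F _ _).
by apply/funext => i; rewrite fconsS.
Qed.

Definition cpred n (P : ('I_n -> nat) -> bool) : Prop :=
  cfun (fun v => nat_of_bool (P v)).

Lemma cpred_not n (P : ('I_n -> nat) -> bool) : cpred P -> cpred (fun v => ~~ P v).
Proof.
move=> HP; apply: (@cfun_ext _ _ (fun v => 1 - P v)); first by move=> v; case: (P v).
by apply: cfun_sub => //; apply: cfun_const.
Qed.

Lemma cpred_and n (P Q : ('I_n -> nat) -> bool) :
  cpred P -> cpred Q -> cpred (fun v => P v && Q v).
Proof.
move=> HP HQ; apply: (@cfun_ext _ _ (fun v => P v * Q v)); last exact: cfun_mul.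
by move=> v; rewrite mulnb.
Qed.

Lemma cpred_implies n (P Q : ('I_n -> nat) -> bool) :
  cpred P -> cpred Q -> cpred (fun v => P v ==> Q v).
Proof.
move=> HP HQ; apply: (@cfun_ext _ _ (fun v => nat_of_bool (~~ (P v && ~~ Q v)))).
  by move=> v; case: (P v); case: (Q v).
by apply/cpred_not/cpred_and => //; apply: cpred_not.
Qed.

Lemma cpred_leq n (f g : ('I_n -> nat) -> nat) :
  cfun f -> cfun g -> cpred (fun v => f v <= g v).
Proof.
move=> Hf Hg; apply: (@cfun_ext _ _ (fun v => 1 - (f v - g v))).
  by move=> v; rewrite /leq; case: (_ - _).
by apply: cfun_sub; [apply: cfun_const|apply: cfun_sub].
Qed.

Lemma cpred_eq n (f g : ('I_n -> nat) -> nat) :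
  cfun f -> cfun g -> cpred (fun v => f v == g v).
Proof.
move=> Hf Hg.
apply: (@cfun_ext _ _ (fun v => nat_of_bool ((f v <= g v) && (g v <= f v)))).
  by move=> v; rewrite eqn_leq.
by apply: cpred_and; apply: cpred_leq.
Qed.

Lemma iota0S k : iota 0 k.+1 = iota 0 k ++ [:: k].
Proof. by rewrite -addn1 iotaD. Qed.

Lemma sum_nat_of_bool (P : pred nat) k : \sum_(i < k) P i = count P (iota 0 k).
Proof.
elim: k => [|k IH]; first by rewrite big_ord0.
by rewrite big_ord_recr iota0S count_cat /= addn0 IH.
Qed.

Lemma cpred_all n (P : nat -> ('I_n -> nat) -> bool) (b : ('I_n -> nat) -> nat) :
  cpred (fun v : 'I_n.+1 -> nat => P (v ord0) (fun i => v (lift ord0 i))) ->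
  cfun b -> cpred (fun v => all (fun i => P i v) (iota 0 (b v))).
Proof.
move=> HP Hb.
apply: (@cfun_ext _ _ (fun v => nat_of_bool (b v <= \sum_(i < b v) P i v))).
  move=> v; congr nat_of_bool.
  rewrite (sum_nat_of_bool (fun i => P i v)).
  rewrite all_count size_iota eqn_leq andbC; case: leqP => //= _.
  by rewrite -{2}(size_iota 0 (b v)) count_size.
by apply: cpred_leq => //; apply: (@cfun_sum _ (fun i v => P i v : nat) b).
Qed.

Lemma cfun_if n (P : ('I_n -> nat) -> bool) (f g : ('I_n -> nat) -> nat) :
  cpred P -> cfun f -> cfun g -> cfun (fun v => if P v then f v else g v).
Proof.
move=> HP Hf Hg; apply: (@cfun_ext _ _ (fun v => P v * f v + ~~ P v * g v)).
  by move=> v; case: (P v); rewrite /= ?mul1n ?mul0n ?addn0.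
by apply: cfun_add; apply: cfun_mul => //; apply: cpred_not.
Qed.

Lemma cpred_if n (P Q R : ('I_n -> nat) -> bool) :
  cpred P -> cpred Q -> cpred R -> cpred (fun v => if P v then Q v else R v).
Proof.
move=> HP HQ HR.
apply: (@cfun_ext _ _ (fun v => if P v then nat_of_bool (Q v) else nat_of_bool (R v))).
  by move=> v; case: (P v).
exact: cfun_if.
Qed.

Lemma cfun_comp1 n (F : nat -> nat) (f : ('I_n -> nat) -> nat) :
  cfun (fun v : 'I_1 -> nat => F (v ord0)) -> cfun f -> cfun (fun v => F (f v)).
Proof. by move=> HF Hf; apply: (cfun_comp (g := fun _ => f) HF). Qed.

Lemma cfun_comp2 n (F : nat -> nat -> nat) (f g : ('I_n -> nat) -> nat) :
  cfun (fun v : 'I_2 -> nat => F (v ord0) (v (lift ord0 ord0))) ->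
  cfun f -> cfun g -> cfun (fun v => F (f v) (g v)).
Proof.
move=> HF Hf Hg.
apply: (cfun_comp (g := fun i : 'I_2 => if i == ord0 then f else g) HF) => i.
by case: eqP.
Qed.

Ltac cfun_more := fail.

Ltac cfun_step := cbv beta zeta; first [cfun_more | lazymatch goal with
  | H : cfun ?f |- cfun ?f => exact H
  | |- cfun (fun v => nat_of_bool (@?P v)) => change (cpred P); cbv beta
  | |- cfun (fun _ => ?n) => exact: cfun_const
  | |- cfun (fun v => v _) => exact: cfun_var
  | |- cfun (fun v => @?f v + @?g v) => apply: (@cfun_add _ f g)
  | |- cfun (fun v => @?f v * @?g v) => apply: (@cfun_mul _ f g)
  | |- cfun (fun v => @?f v - @?g v) => apply: (@cfun_sub _ f g)
  | |- cfun (fun v => @?f v ^ @?g v) => apply: (@cfun_expn _ f g)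
  | |- cfun (fun v => (@?f v).+1) => apply: (@cfun_succ _ f)
  | |- cfun (fun v => (@?f v).-1) => apply: (@cfun_pred _ f)
  | |- cpred (fun v => ~~ @?P v) => apply: (@cpred_not _ P)
  | |- cpred (fun v => @?P v && @?Q v) => apply: (@cpred_and _ P Q)
  | |- cpred (fun v => @?P v ==> @?Q v) => apply: (@cpred_implies _ P Q)
  | |- cpred (fun v => @?f v <= @?g v) => apply: (@cpred_leq _ f g)
  | |- cpred (fun v => @?f v == @?g v) => apply: (@cpred_eq _ f g)
  end].

(** * Divisibility, primality and prime exponents *)

Lemma cpred_dvdn n (f g : ('I_n -> nat) -> nat) :
  cfun f -> cfun g -> cpred (fun v => f v %| g v).
Proof.
apply: (@cfun_comp2 _ (fun d m => d %| m)).
apply: (@cfun_ext _ _ (fun v => nat_of_bool (~~ all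
   (fun q => ~~ (q * v ord0 == v (lift ord0 ord0))) (iota 0 (v (lift ord0 ord0)).+1)))).
  move=> v; move: (v ord0) (v (lift ord0 ord0)) => d m; rewrite -has_predC; congr nat_of_bool.
  apply/dvdnP/hasP => [[q E]|[q _ /=]]; last by rewrite negbK => /eqP <-; exists q.
  have [m0|m0] := posnP m.
    by exists 0; [rewrite mem_iota|rewrite /= negbK mul0n m0].
  exists q; last by rewrite /= E eqxx.
  rewrite mem_iota /= add0n ltnS E leq_pmulr //.
  by rewrite E muln_gt0 in m0; case/andP: m0.
apply: cpred_not.
apply: (@cpred_all _ (fun q v => ~~ (q * v ord0 == v (lift ord0 ord0)))).
  by repeat cfun_step.
by repeat cfun_step.
Qed.

Lemma cpred_prime n (f : ('I_n -> nat) -> nat) :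
  cfun f -> cpred (fun v => prime (f v)).
Proof.
apply: (@cfun_comp1 _ (fun p => prime p)).
apply: (@cfun_ext _ _ (fun v => nat_of_bool ((1 < v ord0) && all
   (fun d => (d %| v ord0) ==> (d == 1)) (iota 0 (v ord0))))).
  move=> v; move: (v ord0) => p; congr nat_of_bool.
  apply/primeP/andP => [[p1 H]|[p1 /allP H]]; split=> //.
    apply/allP => d; rewrite mem_iota /= add0n => dp; apply/implyP => /H/orP[//|/eqP E].
    by rewrite E ltnn in dp.
  move=> d dp; rewrite /= orbC; case: (eqVneq d p) => //= ne.
  have := H d; rewrite mem_iota /= add0n ltn_neqAle ne dvdn_leq ?(ltnW p1) // dp.
  exact.
apply: cpred_and; first by repeat cfun_step.
apply: (@cpred_all _ (fun d v => (d %| v ord0) ==> (d == 1))); last exact: cfun_var.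
by apply: cpred_implies; [apply: cpred_dvdn|]; repeat cfun_step.
Qed.

(** At most one term of the sum is nonzero: the selected [i] with exactly [j] selected predecessors.
    If there is none, both sides are the default 0. *)
Lemma nth_filter_iota (P : pred nat) (F : nat -> nat) b j :
  nth 0 [seq F i | i <- iota 0 b & P i] j
  = \sum_(i < b) (P i && (\sum_(q < i) P q == j)) * F i.
Proof.
elim: b => [|b IH]; first by rewrite big_ord0 nth_nil.
rewrite iota0S filter_cat map_cat nth_cat size_map size_filter big_ord_recr /= -IH.
rewrite sum_nat_of_bool; case: ltnP => [lt|le] /=.
  by rewrite (gtn_eqF lt) andbF addn0.
rewrite [X in _ = X + _]nth_default ?size_map ?size_filter //.
case: (P b) => /=; last by rewrite nth_nil.
have [->|ne] := eqVneq; first by rewrite subnn mul1n.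
have : 0 < j - count P (iota 0 b) by rewrite subn_gt0 ltn_neqAle ne.
by case: (_ - _) => [//|k _] /=; rewrite nth_nil.
Qed.

Definition prime_dvd (p m : nat) : bool := prime p && (p %| m).

Lemma primes_filter m : 0 < m -> primes m = [seq p <- iota 0 m.+1 | prime_dvd p m].
Proof.
move=> m0; apply: (irr_sorted_eq ltn_trans ltnn (sorted_primes m)).
  by apply: sorted_filter; [apply: ltn_trans|apply: iota_ltn_sorted].
move=> p; rewrite mem_primes mem_filter mem_iota m0 /prime_dvd /= add0n ltnS.
case: prime => //=; case: (boolP (p %| m)) => //= pm.
by rewrite dvdn_leq.
Qed.

(** The range [k < m] misses nothing when [1 < p] and [0 < m], since [p ^ k %| m] gives
    [k < p ^ k <= m]. *)
Definition logn_sum (p m : nat) : nat := \sum_(k < m) ((0 < k) && (p ^ k %| m)).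

Lemma logn_sumE p m : prime p -> logn p m = logn_sum p m.
Proof.
move=> pp; rewrite logn_count_dvd // /logn_sum.
case: m => [|m]; first by rewrite big_geq // big_ord0.
by rewrite big_ord_recl /= add0n big_add1 big_mkord.
Qed.

Lemma nth_exponents m j : nth 0 (exponents m) j =
  \sum_(p < m.+1) (prime_dvd p m && (\sum_(q < p) prime_dvd q m == j)) * logn_sum p m.
Proof.
case: (posnP m) => [->|m0]; first by rewrite nth_nil big_ord_recr big_ord0.
transitivity (nth 0 [seq logn_sum i m | i <- iota 0 m.+1 & prime_dvd i m] j);
  last exact: (nth_filter_iota (fun p => prime_dvd p m) (fun p => logn_sum p m)).
rewrite exponentsE primes_filter //.
congr nth; apply/eq_in_map => p; rewrite mem_filter => /andP[/andP[pp _] _].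
exact: logn_sumE.
Qed.

Lemma size_exponents m : size (exponents m) = \sum_(p < m.+1) prime_dvd p m.
Proof.
case: (posnP m) => [->|m0]; first by rewrite big_ord_recr big_ord0.
rewrite exponentsE size_map primes_filter // size_filter.
by rewrite (sum_nat_of_bool (fun p => prime_dvd p m)).
Qed.

Lemma cpred_prime_dvd n (f g : ('I_n -> nat) -> nat) :
  cfun f -> cfun g -> cpred (fun v => prime_dvd (f v) (g v)).
Proof.
by move=> Hf Hg; apply: cpred_and; [apply: cpred_prime|apply: cpred_dvdn].
Qed.

Ltac cfun_more ::= lazymatch goal with
  | |- cpred (fun v => prime_dvd (@?f v) (@?g v)) =>
       apply: (@cpred_prime_dvd _ f g)
  | |- cpred (fun v => prime (@?f v)) => apply: (@cpred_prime _ f)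
  | |- cpred (fun v => @?f v %| @?g v) => apply: (@cpred_dvdn _ f g)
  end.

Lemma cfun_size_exponents n (f : ('I_n -> nat) -> nat) :
  cfun f -> cfun (fun v => size (exponents (f v))).
Proof.
apply: (@cfun_comp1 _ (fun m => size (exponents m))).
apply: (cfun_ext (fun v => size_exponents (v ord0))).
by apply: (@cfun_sum _ (fun p v => prime_dvd p (v ord0) : nat)); repeat cfun_step.
Qed.

Lemma cfun_nth_exponents n (f g : ('I_n -> nat) -> nat) :
  cfun f -> cfun g -> cfun (fun v => nth 0 (exponents (f v)) (g v)).
Proof.
apply: (@cfun_comp2 _ (fun m j => nth 0 (exponents m) j)).
apply: (cfun_ext (fun v => nth_exponents (v ord0) (v (lift ord0 ord0)))).
apply: (@cfun_sum _ (fun p v => (prime_dvd p (v ord0) &&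
  (\sum_(q < p) prime_dvd q (v ord0) == v (lift ord0 ord0))) * logn_sum p (v ord0)));
  last by repeat cfun_step.
apply: cfun_mul.
  apply: cpred_and; first by repeat cfun_step.
  apply: cpred_eq; last by repeat cfun_step.
  by apply: (@cfun_sum _ (fun q v => prime_dvd q (v (lift ord0 ord0)) : nat)); repeat cfun_step.
apply: (@cfun_sum _ (fun k v => (0 < k) && (v ord0 ^ k %| v (lift ord0 ord0)) : nat));
  by repeat cfun_step.
Qed.

Ltac cfun_more ::= lazymatch goal with
  | |- cfun (fun v => nth 0 (exponents (@?f v)) (@?g v)) =>
       apply: (@cfun_nth_exponents _ f g)
  | |- cfun (fun v => size (exponents (@?f v))) => apply: (@cfun_size_exponents _ f)
  | |- cpred (fun v => all (fun i => @?P v i) (iota 0 (@?b v))) =>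
       apply: (@cpred_all _ (fun i v => P v i) b)
  end.

Lemma nth_witness m j : nth 0 (witness m) j = (nth 0 (exponents m) j).-1.
Proof.
have [lt|ge] := ltnP j (size (exponents m)); first by rewrite (nth_map 0).
by rewrite [RHS](congr1 predn (nth_default _ ge)) nth_default // size_map.
Qed.

(** * Computability of the acceptance test *)

Definition in_range (m a : nat) : bool := (0 < a) && (a <= size (exponents m)).
Definition value (m a : nat) : nat := (nth 0 (exponents m) a.-1).-1.

Definition check_equation (m k a b c : nat) : bool :=
  if k == 1 then in_range m a && (value m a == 1)
  else if k == 2 then
    in_range m a && (in_range m b && (in_range m c && (value m a + value m b == value m c)))
  else
    in_range m a && (in_range m b && (in_range m c && (value m a * value m b == value m c))).

Lemma cpred_check_equation n (m k a b c : ('I_n -> nat) -> nat) :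
  cfun m -> cfun k -> cfun a -> cfun b -> cfun c ->
  cpred (fun v => check_equation (m v) (k v) (a v) (b v) (c v)).
Proof.
move=> Hm Hk Ha Hb Hc; rewrite /check_equation /in_range /value.
by apply: cpred_if; [|idtac|apply: cpred_if]; repeat cfun_step.
Qed.

(** The quotient by 4 is traded for a guard under a longer range, so that only bounded
    quantification and arithmetic already known to be computable occur. *)
Lemma acceptsE n m : accepts n m = (1 < m) &&
  all (fun i => (4 * i.+1 <= size (exponents (210 * n.+1))) ==>
    check_equation m
      (nth 0 (exponents (210 * n.+1)) (4 * i.+1).-1)
      (nth 0 (exponents (210 * n.+1)) (4 * i.+1 - 3).-1)
      (nth 0 (exponents (210 * n.+1)) (4 * i.+1 - 2).-1)
      (nth 0 (exponents (210 * n.+1)) (4 * i.+1 - 1).-1))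
   (iota 0 (size (exponents (210 * n.+1)))).
Proof.
rewrite /accepts; congr (_ && _); rewrite /system all_map; set ts := exponents _.
have C i : satisfies (witness m)
    (if nth 0 ts (4 * i).-1 == 1 then EqOne (nth 0 ts (4 * i - 3).-1)
    else if nth 0 ts (4 * i).-1 == 2
         then EqAdd (nth 0 ts (4 * i - 3).-1) (nth 0 ts (4 * i - 2).-1) (nth 0 ts (4 * i - 1).-1)
         else EqMul (nth 0 ts (4 * i - 3).-1) (nth 0 ts (4 * i - 2).-1) (nth 0 ts (4 * i - 1).-1))
  = check_equation m (nth 0 ts (4 * i).-1) (nth 0 ts (4 * i - 3).-1)
      (nth 0 ts (4 * i - 2).-1) (nth 0 ts (4 * i - 1).-1).
  have E : size (witness m) = size (exponents m) by rewrite size_map.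
  by rewrite /check_equation /in_range /value; case: ifP => [_|_];
    [|case: ifP => _]; rewrite /= E !nth_witness.
apply/allP/allP => [H i|H [|i]].
- rewrite mem_iota => _; apply/implyP => le; rewrite -C; apply: (H i.+1).
  have le' : i.+1 <= size ts %/ 4 by rewrite leq_divRL // mulnC.
  by rewrite mem_iota add1n.
- by rewrite mem_iota.
- rewrite mem_iota add1n => /andP[_ le']; have {}le' : i.+1 <= size ts %/ 4 by [].
  rewrite leq_divRL // mulnC in le'; rename le' into le; rewrite /= C.
  have := H i; rewrite mem_iota /= add0n le /= => -> //.
  by apply: leq_trans le; rewrite leq_pmull.
Qed.

Lemma cpred_accepts n (f g : ('I_n -> nat) -> nat) :
  cfun f -> cfun g -> cpred (fun v => accepts (f v) (g v)).
Proof.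
apply: (@cfun_comp2 _ (fun n m => accepts n m)).
apply: (cfun_ext (fun v => congr1 nat_of_bool (acceptsE (v ord0) (v (lift ord0 ord0))))).
apply: cpred_and; first by repeat cfun_step.
apply: (@cpred_all _ (fun i v => _)); last by repeat cfun_step.
apply: cpred_implies; first by repeat cfun_step.
by apply: cpred_check_equation; repeat cfun_step.
Qed.

(** * The outputs and their limit *)

Lemma answerE m : answer m = \max_(j < size (exponents m)) (nth 0 (exponents m) j).-1.
Proof.
rewrite /answer (big_nth 0) big_mkord size_map.
by apply: eq_bigr => j _; rewrite nth_witness.
Qed.

Lemma cfun_answer n (f : ('I_n -> nat) -> nat) :
  cfun f -> cfun (fun v => answer (f v)).
Proof.
apply: (@cfun_comp1 _ answer); apply: (cfun_ext (fun v => answerE (v ord0))).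
apply: (@cfun_max _ (fun j v => (nth 0 (exponents (v ord0)) j).-1));
  by repeat cfun_step.
Qed.

(** The default value of [nth] plays the part of the initial output 0. *)
Lemma last_outputE n l :
  last_output n l = nth 0 [seq answer m | m <- iota 2 l & accepts n m] 0.
Proof.
rewrite /last_output /outputs; case: [seq m <- iota 2 l | _] => [|m s] //=.
by rewrite take0.
Qed.

Lemma last_output_sum n l : last_output n l =
  \sum_(i < l) (accepts n i.+2 && (\sum_(q < i) accepts n q.+2 == 0)) * answer i.+2.
Proof.
rewrite last_outputE -(nth_filter_iota (fun i => accepts n i.+2) (fun i => answer i.+2)).
by rewrite -[2]/(2 + 0) iotaDl filter_map -map_comp.
Qed.

Lemma computable2_last_output : computable2 last_output.
Proof.
suff [e He] : cfun (fun v : 'I_2 -> nat => last_output (v ord0) (v (lift ord0 ord0))).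
  exists e => x y; have := He (fun i => if i == ord0 then x else y).
  by congr rgraph; apply: eq_from_tnth => -[[|[|//]] lt]; rewrite tnth_mktuple.
apply: (cfun_ext (fun v => last_output_sum (v ord0) (v (lift ord0 ord0)))).
apply: (@cfun_sum _ (fun i v => (accepts (v ord0) i.+2 &&
  (\sum_(q < i) accepts (v ord0) q.+2 == 0)) * answer i.+2)); last by repeat cfun_step.
apply: cfun_mul; last by apply: cfun_answer; repeat cfun_step.
apply: cpred_and; first by apply: cpred_accepts; repeat cfun_step.
apply: cpred_eq; last by repeat cfun_step.
apply: (@cfun_sum _ (fun q v => accepts (v (lift ord0 ord0)) q.+2 : nat));
  last by repeat cfun_step.
by apply: cpred_accepts; repeat cfun_step.
Qed.

Lemma last_output_limit n : has_limit (last_output n) (xi n).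
Proof.
rewrite /xi; case: pselect => [ex|nex]; last first.
  exists 0 => l _; rewrite last_outputE (@eq_filter _ _ pred0) ?filter_pred0 //.
  by move=> m; apply/negP => H; apply: nex; exists m.
case: ex_minnP => m acc mmin; exists m => l ml; rewrite last_outputE.
have m1 : 1 < m by case/andP: acc.
(* Candidates start at 2, so [m] sits at offset [m - 2]; by minimality nothing before it is
   accepted. *)
have -> : l = (m - 2) + (1 + (l - m).+1) by lia.
rewrite !iotaD !filter_cat (@eq_in_filter _ _ pred0) ?filter_pred0 /=.
  by rewrite subnKC // acc.
move=> k; rewrite mem_iota subnKC // => /andP[_ km]; apply/negP => /mmin.
by rewrite leqNgt km.
Qed.

Theorem theorem4 :
  [/\ limit_computable xi,
      computable2 last_output
      /\ (forall n : nat, outputs n 0 = [:: 0]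
                          /\ has_limit (last_output n) (xi n))
    & forall Gamma : nat -> nat,
        computable Gamma -> exists n : nat, Gamma n < xi n].
Proof.
have H := computable2_last_output.
split; first by exists last_output => // n; apply: last_output_limit.
  by split=> // n; split=> //; apply: last_output_limit.
exact: xi_unbounded.
Qed.
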